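(* The specialization at $v=1$ of the (quantum) Frobenius map $\Psi:\mathcal Z\to\Lambda_v$ coincides with the classical Frobenius map $\psi:\bigoplus_{n\ge0}\mathcal Z(\mathbb C\mathfrak S_n)\to\Lambda$. That is, for every partition $\lambda$, the element $f^*_\lambda$ specializes at $v=1$ to the class sum $c_\lambda$, and $\Psi(f^*_\lambda)|_{v=1}=\psi(c_\lambda)$.
   Context: Hecke algebra: $\mathfrak S_n$ is the symmetric group on $n$ letters with simple transpositions $s_i=(i,i+1)$ and length function $\ell$; $v$ is an indeterminate. $\mathcal H_n$ is the unital $\mathbb C(v)$-algebra generated by $T_1,\dots,T_{n-1}$ with relations $(T_k-v)(T_k+1)=0$, $T_kT_{k+1}T_k=T_{k+1}T_kT_{k+1}$, $T_kT_l=T_lT_k$ for $|k-l|>1$ ($\mathcal H_0=\mathbb C(v)$). For a reduced expression $w=s_{i_1}\cdots s_{i_r}$ put $T_w=T_{i_1}\cdots T_{i_r}$; $\{T_w\}_{w\in\mathfrak S_n}$ is a basis of $\mathcal H_n$. Specialization at $v=1$ sends $\sum_w a_w(v)T_w$, with all $a_w(v)$ regular at $v=1$, to $\sum_wa_w(1)w\in\mathbb C\mathfrak S_n$. $\mathcal Z(A)$ is the center of $A$, $\mathcal Z=\bigoplus_{n\ge0}\mathcal Z(\mathcal H_n)$, and $\mathcal P_n$ is the set of partitions of $n$. Geck–Rouquier elements: for $\lambda=(\lambda_1,\dots,\lambda_\ell)\in\mathcal P_n$ let $w_\lambda=(1,\dots,\lambda_1)(\lambda_1+1,\dots,\lambda_1+\lambda_2)\cdots(\lambda_1+\cdots+\lambda_{\ell-1}+1,\dots,n)$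 (product of cycles). It is known that for each $w\in\mathfrak S_n$ there are unique $f_{w,\lambda}\in\mathbb Z[v,v^{-1}]$ with $T_w\equiv\sum_{\lambda\in\mathcal P_n}f_{w,\lambda}T_{w_\lambda}\bmod[\mathcal H_n,\mathcal H_n]$. Set $f^*_\lambda=\sum_{w\in\mathfrak S_n}v^{-\ell(w)}f_{w,\lambda}T_{w^{-1}}$; the $f^*_\lambda$, $\lambda\in\mathcal P_n$, form a basis of $\mathcal Z(\mathcal H_n)$. Frobenius map: $\Lambda$ is the ring of symmetric functions over $\mathbb C$ in $x=\{x_1,x_2,\dots\}$ and $\Lambda_v=\mathbb C(v)\otimes_{\mathbb C}\Lambda$. For $f\in\Lambda_v$, $f\big(\tfrac{x}{v-1}\big)$ is the image of $f$ under the $\mathbb C(v)$-algebra endomorphism of $\Lambda_v$ sending the power sum $p_k(x)$ to $\frac{p_k(x)}{v^k-1}$ for all $k\ge1$. $\Psi:\mathcal Z\to\Lambda_v$ is the $\mathbb C(v)$-linear map with $\Psi(f^*_\lambda)=\underline{m}_\lambda(x):=(v-1)^{\ell(\lambda)}m_\lambda\big(\tfrac{x}{v-1}\big)$ for all partitions $\lambda$, where $m_\lambda$ is the monomial symmetric function and $\ell(\lambda)$ the number of parts. For $f\in\Lambda_v$, $f|_{v=1}\in\Lambda$ denotes, when possible, the specialization at $v=1$ of the coefficients of $f$ with respect to a $\mathbb C$-basis of $\Lambda$ (e.g. the $p_\mu$). Classical Frobenius map: $c_\lambda\in\mathbb C\mathfrak S_n$ is the sum of all permutations of cycle type $\lambda$;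 for $\lambda=(1^{m_1}2^{m_2}\cdots)$, $z_\lambda=\prod_{i\ge1}i^{m_i}m_i!$; and $\psi$ is the $\mathbb C$-linear isomorphism $\bigoplus_{n\ge0}\mathcal Z(\mathbb C\mathfrak S_n)\to\Lambda$ with $\psi(c_\lambda)=\frac1{z_\lambda}p_\lambda(x)$. *)

(* Defs.v *)
From HB Require Import structures.
From mathcomp Require Import all_boot all_order all_fingroup all_algebra.
From mathcomp Require Import boolp reals complex.
From mathcomp Require monalg.
From mathcomp Require Import mpoly.

Set Implicit Arguments.
Unset Strict Implicit.
Unset Printing Implicit Defensive.

Import Order.TTheory GRing.Theory.

Local Open Scope ring_scope.

Definition is_part (s : seq nat) : bool := sorted geq s && (0%N \notin s).

Section IntPart.
Variable n : nat.

(* Bounding the number of parts and their sizes by [n] loses no partition of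
   [n] (see [intpart_complete]) and makes the type finite. *)
Record intpart := IntPart {
  intpart_bseq : n.-bseq 'I_n.+1;
  _ : is_part (map val intpart_bseq) && (sumn (map val intpart_bseq) == n)
}.

HB.instance Definition _ := [isSub for intpart_bseq].
HB.instance Definition _ := [Finite of intpart by <:].

Definition parts (l : intpart) : seq nat := map val (intpart_bseq l).

Lemma parts_is_part l : is_part (parts l).
Proof. by rewrite /parts; case: l => b h; case/andP: (h). Qed.

Lemma sumn_parts l : sumn (parts l) = n.
Proof. by rewrite /parts; case: l => b h; case/andP: (h) => _ /eqP. Qed.

Lemma intpart_complete s : is_part s -> sumn s = n -> exists l, parts l = s.
Proof.
move=> ps sn.
have le x : x \in s -> (x < n.+1)%N.
  rewrite -{}sn ltnS {ps}; elim: s => //= y s IH; rewrite inE => /orP[/eqP->|/IH h].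
    exact: leq_addr.
  by rewrite (leq_trans h) ?leq_addl.
have sz : (size (map (@inord n) s) <= n)%N.
  rewrite size_map -{le}sn; case/andP: ps => _; elim: s => //= y s IH.
  rewrite inE negb_or => /andP[y0 /IH h]; rewrite -add1n leq_add //.
  by rewrite lt0n eq_sym.
have e : map val (Bseq sz) = s.
  rewrite /= -map_comp map_id_in // => x /le xn /=; exact: inordK.
have P : is_part (map val (Bseq sz)) && (sumn (map val (Bseq sz)) == n).
  by rewrite e ps sn eqxx.
by exists (IntPart P).
Qed.

End IntPart.

Definition zee (s : seq nat) : nat :=
  \prod_(1 <= i < (sumn s).+1) (i ^ count_mem i s * (count_mem i s)`!)%N.

Section Sym.
Variable n : nat.
Local Open Scope group_scope.

Lemma gen_lt (i : 'I_n.-1) : (i < n)%N.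
Proof. by case: n i => [[]//|m] i; rewrite ltnS ltnW ?ltn_ord. Qed.

Lemma genS_lt (i : 'I_n.-1) : (i.+1 < n)%N.
Proof. by case: n i => [[]//|m] i; rewrite ltnS ltn_ord. Qed.

Definition stransp (i : 'I_n.-1) : 'S_n :=
  tperm (Ordinal (gen_lt i)) (Ordinal (genS_lt i)).

(* Products in ['S_n] are read from left to right: [(s * t) x = t (s x)]. *)
Definition sword (s : seq 'I_n.-1) : 'S_n := \prod_(i <- s) stransp i.

Lemma sword_cat s t : sword (s ++ t) = sword s * sword t.
Proof. exact: big_cat. Qed.

Lemma sword_surj w : exists s, sword s = w.
Proof.
have adj (d : nat) (i j : 'I_n) : (j = i + d :> nat)%N -> exists s, sword s = tperm i j.
  elim: d i j => [|d IH] i j.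
    by rewrite addn0 => /val_inj ->; exists [::]; rewrite tperm1 /sword big_nil.
  rewrite addnS => ji.
  have jn : (i + d < n)%N by rewrite -ltnS -ji ltnS ltnW.
  have kn : (i + d < n.-1)%N by rewrite -ltnS (ltn_predK jn) -ji.
  have [s sE] := IH i (Ordinal jn) erefl.
  case: (posnP d) => [d0|d0].
    exists [:: Ordinal kn]; rewrite /sword big_seq1 /stransp.
    by congr tperm; apply: val_inj => /=; rewrite ?ji d0 ?addn0.
  pose k : 'I_n.-1 := Ordinal kn.
  exists ([:: k] ++ s ++ [:: k]); rewrite !sword_cat sE /sword !big_seq1.
  have -> : stransp k * (tperm i (Ordinal jn) * stransp k) =
            tperm i (Ordinal jn) ^ stransp k by rewrite conjgE tpermV.
  rewrite tpermJ /stransp.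
  have -> : Ordinal (gen_lt k) = Ordinal jn by apply: val_inj.
  have -> : Ordinal (genS_lt k) = j by apply: val_inj.
  rewrite tpermL tpermD //; apply/eqP => /(congr1 val) /=.
    by move=> e; move: d0; rewrite -(ltn_add2l i) addn0 e ltnn.
  by move=> e; move: (leq_addr d i); rewrite -ltnS -ji e ltnn.
have [ts -> _] := prod_tpermP w.
elim: ts => [|[i j] ts [s IH]]; first by exists [::]; rewrite /sword !big_nil.
have [u uE] : exists u, sword u = tperm i j.
  case: (leqP i j) => ij; first by apply: (adj (j - i)%N); rewrite subnKC.
  by rewrite tpermC; apply: (adj (i - j)%N); rewrite subnKC // ltnW.
by exists (u ++ s); rewrite sword_cat IH big_cons uE.
Qed.

Lemma ex_length w : exists k, [exists t : k.-tuple 'I_n.-1, sword t == w].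
Proof.
have [s <-] := sword_surj w; exists (size s).
by apply/existsP; exists (in_tuple s).
Qed.

Definition slength (w : 'S_n) : nat := ex_minn (ex_length w).

Lemma ex_reduced w : exists t : (slength w).-tuple 'I_n.-1, sword t == w.
Proof. by rewrite /slength; case: ex_minnP => k /existsP. Qed.

Definition reduced_word (w : 'S_n) : seq 'I_n.-1 := xchoose (ex_reduced w).

Lemma reduced_wordP w : sword (reduced_word w) = w.
Proof. exact/eqP/(xchooseP (ex_reduced w)). Qed.

Lemma size_reduced_word w : size (reduced_word w) = slength w.
Proof. exact: size_tuple. Qed.

Lemma slength_min s : (slength (sword s) <= size s)%N.
Proof.
rewrite /slength; case: ex_minnP => k _; apply.
by apply/existsP; exists (in_tuple s).
Qed.

(* The cycle (b+1, b+2, ..., b+r) in 1-based notation. *)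
Definition block (b r : nat) : seq 'I_n :=
  [seq i : 'I_n <- enum 'I_n | (b <= i < b + r)%N].

Definition block_cycle (b r : nat) : 'S_n :=
  perm (can_inj (prev_next (filter_uniq _ (enum_uniq _) : uniq (block b r)))).

Definition wpart (l : intpart n) : 'S_n :=
  \prod_(j < size (parts l))
     block_cycle (sumn (take j (parts l))) (nth 0%N (parts l) j).

Definition cycle_type (w : 'S_n) : seq nat :=
  sort geq [seq #|(c : {set 'I_n})| | c <- enum (porbits w)].

Lemma porbitJ (w t : 'S_n) x : porbit (w ^ t) (t x) = t @: porbit w x.
Proof.
apply/setP => y; apply/porbitP/imsetP => [[i ->]|[z /porbitP[i ->] ->]].
  exists ((w ^+ i) x); first exact: mem_porbit.
  by rewrite -conjXg permJ.
by exists i; rewrite -conjXg permJ.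
Qed.

Lemma porbitsJ (w t : 'S_n) :
  porbits (w ^ t) = (fun c : {set 'I_n} => t @: c) @: porbits w.
Proof.
apply/setP => c; apply/imsetP/imsetP => [[x _ ->]|[_ /imsetP[x _ ->] ->]].
  exists (porbit w (t^-1 x)); first exact: imset_f.
  by rewrite -porbitJ permKV.
by exists (t x); rewrite // porbitJ.
Qed.

Lemma cycle_typeJ (w t : 'S_n) : cycle_type (w ^ t) = cycle_type w.
Proof.
have tI : injective (fun c : {set 'I_n} => t @: c) by apply/imset_inj/perm_inj.
apply/perm_sortP.
- by move=> x y; apply: leq_total.
- by move=> y x z /= h1 h2; apply: leq_trans h1.
- by move=> x y; rewrite /= -eqn_leq => /eqP.
pose F (c : {set 'I_n}) := [set t x | x in c].
have -> : [seq #|(c : {set 'I_n})| | c <- enum (porbits w)] =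
          [seq #|(c : {set 'I_n})| | c <- map F (enum (porbits w))].
  rewrite -map_comp; apply: eq_map => c /=.
  by rewrite card_imset //; apply: perm_inj.
apply: perm_map; apply: uniq_perm; rewrite ?enum_uniq ?map_inj_uniq ?enum_uniq //.
move=> c; rewrite mem_enum porbitsJ.
by apply/imsetP/mapP => -[d dw ->]; exists d => //; rewrite ?mem_enum // in dw *.
Qed.

End Sym.

Module Export DirectSums.
Section DirectSum.
Variables (K : pzRingType) (V : nat -> lmodType K).

Record dsum := DSum {
  dcomp :> forall n, V n;
  dcomp_fin : exists N, forall n, (N <= n)%N -> dcomp n = 0
}.

HB.instance Definition _ := gen_eqMixin dsum.
HB.instance Definition _ := gen_choiceMixin dsum.

Lemma dsumP (x y : dsum) : (forall n, x n = y n) -> x = y.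
Proof.
case: x y => [x xP] [y yP] /= xy.
have e : x = y by apply: functional_extensionality_dep.
by subst y; congr DSum; apply: Prop_irrelevance.
Qed.

Fact dzero_fin : exists N, forall n, (N <= n)%N -> 0 = 0 :> V n.
Proof. by exists 0%N. Qed.
Definition dzero := DSum dzero_fin.

Fact dopp_fin (x : dsum) : exists N, forall n, (N <= n)%N -> - x n = 0.
Proof. by have [N h] := dcomp_fin x; exists N => n /h ->; rewrite oppr0. Qed.
Definition dopp x := DSum (dopp_fin x).

Fact dadd_fin (x y : dsum) : exists N, forall n, (N <= n)%N -> x n + y n = 0.
Proof.
have [N h] := dcomp_fin x; have [M k] := dcomp_fin y; exists (maxn N M) => n.
by rewrite geq_max => /andP[/h -> /k ->]; rewrite addr0.
Qed.
Definition dadd x y := DSum (dadd_fin x y).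

Fact dscale_fin a (x : dsum) : exists N, forall n, (N <= n)%N -> a *: x n = 0.
Proof. by have [N h] := dcomp_fin x; exists N => n /h ->; rewrite scaler0. Qed.
Definition dscale a x := DSum (dscale_fin a x).

Fact daddA : associative dadd.
Proof. by move=> x y z; apply: dsumP => n /=; rewrite addrA. Qed.
Fact daddC : commutative dadd.
Proof. by move=> x y; apply: dsumP => n /=; rewrite addrC. Qed.
Fact dadd0 : left_id dzero dadd.
Proof. by move=> x; apply: dsumP => n /=; rewrite add0r. Qed.
Fact daddN : left_inverse dzero dopp dadd.
Proof. by move=> x; apply: dsumP => n /=; rewrite addNr. Qed.
HB.instance Definition _ := GRing.isZmodule.Build dsum daddA daddC dadd0 daddN.

Fact dscaleA a b x : dscale a (dscale b x) = dscale (a * b) x.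
Proof. by apply: dsumP => n /=; rewrite scalerA. Qed.
Fact dscale1 : left_id 1 dscale.
Proof. by move=> x; apply: dsumP => n /=; rewrite scale1r. Qed.
Fact dscaleDr : right_distributive dscale +%R.
Proof. by move=> a x y; apply: dsumP => n /=; rewrite scalerDr. Qed.
Fact dscaleDl x : {morph dscale^~ x : a b / a + b}.
Proof. by move=> a b; apply: dsumP => n /=; rewrite scalerDl. Qed.
HB.instance Definition _ :=
  GRing.Zmodule_isLmodule.Build K dsum dscaleA dscale1 dscaleDr dscaleDl.

Definition dinj_fun n (x : V n) m : V m :=
  if n =P m is ReflectT e then ecast i (V i) e x else 0.

Fact dinj_fin n (x : V n) :
  exists N, forall m, (N <= m)%N -> dinj_fun x m = 0.
Proof.
exists n.+1 => m nm; rewrite /dinj_fun; case: eqP => // e.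
by rewrite e ltnn in nm.
Qed.
Definition dinj n (x : V n) := DSum (dinj_fin x).

End DirectSum.
End DirectSums.

Section Center.
Variables (K : comNzRingType) (A : algType K).

Definition central : pred A := fun c => `[< forall x, c * x = x * c >].

Fact central_submod : submod_closed central.
Proof.
split; first by apply/asboolP => x; rewrite mul0r mulr0.
move=> a c d /asboolP cP /asboolP dP; apply/asboolP => x.
by rewrite mulrDl mulrDr -scalerAl -scalerAr cP dP.
Qed.
HB.instance Definition _ := GRing.isSubmodClosed.Build K A central central_submod.

Record center := Center { center_val : A; _ : center_val \in central }.
HB.instance Definition _ := [isSub for center_val].
HB.instance Definition _ := [Choice of center by <:].
HB.instance Definition _ := [SubChoice_isSubLmodule of center by <:].

(* [x] lies in [A, A]; scalars can be absorbed in the first factors. *)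
Definition in_commutators (x : A) : Prop :=
  exists s : seq (A * A), x = \sum_(p <- s) (p.1 * p.2 - p.2 * p.1).

End Center.

Module Export GroupAlgebras.
Section GroupAlgebra.
Variables (K : comNzRingType) (gT : finGroupType).

Definition galg : Type := {ffun gT -> K}.
Implicit Types a b c : galg.

HB.instance Definition _ := GRing.Zmodule.on galg.

Definition gscale (k : K) a : galg := [ffun x => k * a x].
Fact gscaleA k k' a : gscale k (gscale k' a) = gscale (k * k') a.
Proof. by apply/ffunP => x; rewrite !ffunE mulrA. Qed.
Fact gscale1 : left_id 1 gscale.
Proof. by move=> a; apply/ffunP => x; rewrite !ffunE mul1r. Qed.
Fact gscaleDr : right_distributive gscale +%R.
Proof. by move=> k a b; apply/ffunP => x; rewrite !ffunE mulrDr. Qed.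
Fact gscaleDl a : {morph gscale^~ a : k k' / k + k'}.
Proof. by move=> k k'; apply/ffunP => x; rewrite !ffunE mulrDl. Qed.
HB.instance Definition _ :=
  GRing.Zmodule_isLmodule.Build K galg gscaleA gscale1 gscaleDr gscaleDl.

Definition gsingle (x : gT) : galg := [ffun y => (y == x)%:R].
Definition gmul a b : galg := [ffun x => \sum_y a y * b (y^-1 * x)%g].

Fact gmulA : associative gmul.
Proof.
move=> a b c; apply/ffunP => x; rewrite !ffunE.
under eq_bigr => y _ do rewrite ffunE mulr_sumr.
under [RHS]eq_bigr => y _ do rewrite ffunE mulr_suml.
rewrite [RHS]exchange_big /=; apply: eq_bigr => y _.
rewrite (reindex_inj (mulgI y^-1)%g) /=; apply: eq_bigr => z _.
by rewrite mulrA invMg invgK -mulgA mulKVg.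
Qed.
Fact gmul1 : left_id (gsingle 1%g) gmul.
Proof.
move=> a; apply/ffunP => x; rewrite ffunE (bigD1 1%g) //= ffunE eqxx mul1r.
rewrite invg1 mul1g big1 ?addr0 // => y /negPf y1.
by rewrite ffunE y1 mul0r.
Qed.
Fact gmulr1 : right_id (gsingle 1%g) gmul.
Proof.
move=> a; apply/ffunP => x; rewrite ffunE (bigD1 x) //= ffunE mulVg eqxx mulr1.
rewrite big1 ?addr0 // => y yx.
by rewrite ffunE -eq_mulVg1 (negPf yx) mulr0.
Qed.
Fact gmulDl : left_distributive gmul +%R.
Proof.
move=> a b c; apply/ffunP => x; rewrite !ffunE -big_split /=.
by apply: eq_bigr => y _; rewrite ffunE mulrDl.
Qed.
Fact gmulDr : right_distributive gmul +%R.
Proof.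
move=> a b c; apply/ffunP => x; rewrite !ffunE -big_split /=.
by apply: eq_bigr => y _; rewrite ffunE mulrDr.
Qed.
Fact gone_neq0 : gsingle 1%g != 0.
Proof.
by apply/eqP => /ffunP/(_ 1%g); rewrite !ffunE eqxx => /eqP; rewrite oner_eq0.
Qed.
HB.instance Definition _ :=
  GRing.Zmodule_isNzRing.Build galg gmulA gmul1 gmulr1 gmulDl gmulDr gone_neq0.

Fact gscaleAl (k : K) a b : k *: (a * b) = (k *: a) * b.
Proof.
apply/ffunP => x; rewrite !ffunE mulr_sumr.
by apply: eq_bigr => y _; rewrite ffunE mulrA.
Qed.
HB.instance Definition _ := GRing.Lmodule_isLalgebra.Build K galg gscaleAl.
Fact gscaleAr (k : K) a b : k *: (a * b) = a * (k *: b).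
Proof.
apply/ffunP => x; rewrite !ffunE mulr_sumr.
by apply: eq_bigr => y _; rewrite ffunE mulrCA.
Qed.
HB.instance Definition _ := GRing.Lalgebra_isAlgebra.Build K galg gscaleAr.

End GroupAlgebra.
End GroupAlgebras.

Section ClassSum.
Variables (K : comNzRingType) (n : nat).

Definition class_sum_elt (l : intpart n) : galg K 'S_n :=
  \sum_(w : 'S_n | cycle_type w == parts l) gsingle K w.

Lemma class_sum_eltE l w :
  class_sum_elt l w = (cycle_type w == parts l)%:R.
Proof.
rewrite /class_sum_elt sum_ffunE.
have [h|h] := boolP (cycle_type w == parts l).
  rewrite (bigD1 w) //= ffunE eqxx big1 ?addr0 // => y /andP[_ yw].
  by rewrite ffunE eq_sym (negPf yw).
rewrite big1 // => y hy; rewrite ffunE; case: eqP => // wy.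
by rewrite wy hy in h.
Qed.

Fact class_sum_central l : class_sum_elt l \in @central K (galg K 'S_n).
Proof.
apply/asboolP => a; apply/ffunP => x; rewrite !ffunE.
rewrite (reindex_inj (inj_comp (mulgI x) invg_inj)) /=.
apply: eq_bigr => y _; rewrite !class_sum_eltE invMg invgK mulgKV mulrC.
by rewrite -[in RHS](cycle_typeJ _ y^-1) conjgE invgK !mulgA mulgV mul1g.
Qed.
Definition class_sum l : center (galg K 'S_n) := Center (class_sum_central l).

End ClassSum.

Module Export HeckeAlgebra.
Section Hecke.
Import monalg.
Variables (K : comNzRingType) (q : K) (n : nat).

Definition freealg := {malg K[{fmonom 'I_n.-1}]}.
HB.instance Definition _ := GRing.Lalgebra.on freealg.

Definition free_gen (i : 'I_n.-1) : freealg := << fmu i >>.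

Inductive hecke_relation : freealg -> Prop :=
| hecke_quad (i : 'I_n.-1) :
    hecke_relation ((free_gen i - q%:A) * (free_gen i + 1))
| hecke_braid (i j : 'I_n.-1) of j = i.+1 :> nat :
    hecke_relation (free_gen i * free_gen j * free_gen i -
                    free_gen j * free_gen i * free_gen j)
| hecke_comm (i j : 'I_n.-1) of (i.+1 < j)%N :
    hecke_relation (free_gen i * free_gen j - free_gen j * free_gen i).

Inductive hecke_ideal : freealg -> Prop :=
| hecke_ideal0 : hecke_ideal 0
| hecke_idealD x y of hecke_ideal x & hecke_ideal y : hecke_ideal (x + y)
| hecke_ideal_gen x r y of hecke_relation r : hecke_ideal (x * r * y).

Fact hecke_idealMl a x : hecke_ideal x -> hecke_ideal (a * x).
Proof.
elim=> [|y z _ h _ k|y r z h]; first by rewrite mulr0; constructor.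
  by rewrite mulrDr; constructor.
by rewrite !mulrA; constructor.
Qed.
Fact hecke_idealMr a x : hecke_ideal x -> hecke_ideal (x * a).
Proof.
elim=> [|y z _ h _ k|y r z h]; first by rewrite mul0r; constructor.
  by rewrite mulrDl; constructor.
by rewrite -mulrA; constructor.
Qed.

Definition hecke_idealb : pred freealg := fun x => `[< hecke_ideal x >].
Fact hecke_idealb_zmod : zmod_closed hecke_idealb.
Proof.
split=> [|x y /asboolP hx /asboolP hy]; apply/asboolP; first by constructor.
by constructor => //; rewrite -mulN1r; apply: hecke_idealMl.
Qed.
HB.instance Definition _ := GRing.isZmodClosed.Build freealg hecke_idealb hecke_idealb_zmod.

(* The one-dimensional representation sending every generator to [q]; it shows
   that the quotient by [hecke_ideal] is not zero. *)
Definition hecke_eps_mon (m : {fmonom 'I_n.-1}) : K := q ^+ size m.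
Fact hecke_eps_mon_mmorphism : mmorphism hecke_eps_mon.
Proof. by split=> [x y|]; rewrite /hecke_eps_mon ?fm1 // fmM size_cat exprD. Qed.
HB.instance Definition _ :=
  isMultiplicative.Build {fmonom 'I_n.-1} K hecke_eps_mon hecke_eps_mon_mmorphism.
Definition hecke_eps (x : freealg) : K := mmap idfun hecke_eps_mon x.
Fact hecke_eps_multiplicative : {morph hecke_eps : x y / x * y}.
Proof. exact: (mmap_is_multiplicative (f := idfun) (h := hecke_eps_mon)).1. Qed.
Fact hecke_epsX i : hecke_eps (free_gen i) = q.
Proof. by rewrite /hecke_eps /free_gen mmapU mul1r /hecke_eps_mon fmU. Qed.
Fact hecke_eps1 : hecke_eps 1 = 1.
Proof. exact: mmap1. Qed.
Fact hecke_epsZ a x : hecke_eps (a *: x) = a * hecke_eps x.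
Proof. exact: mmapZ. Qed.
Fact hecke_epsB x y : hecke_eps (x - y) = hecke_eps x - hecke_eps y.
Proof. exact: mmapB. Qed.
Fact hecke_epsD x y : hecke_eps (x + y) = hecke_eps x + hecke_eps y.
Proof. exact: mmapD. Qed.
Fact hecke_eps_ideal x : hecke_ideal x -> hecke_eps x = 0.
Proof.
elim=> [|y z _ h _ k|y r z h]; first exact: mmap0.
  by rewrite hecke_epsD h k addr0.
suff r0 : hecke_eps r = 0 by rewrite !hecke_eps_multiplicative r0 mulr0 mul0r.
have e2 i j : hecke_eps (free_gen i * free_gen j) = q * q.
  by rewrite (hecke_eps_multiplicative (free_gen i) (free_gen j)) !hecke_epsX.
have e3 i j k : hecke_eps (free_gen i * free_gen j * free_gen k) = q * q * q.
  rewrite (hecke_eps_multiplicative (free_gen i * free_gen j) (free_gen k)).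
  by rewrite e2 hecke_epsX.
case: h => [i|i j _|i j _]; last 2 first.
- apply: etrans (hecke_epsB _ _) _; apply/eqP; rewrite subr_eq0; apply/eqP.
  exact: etrans (e3 i j i) (esym (e3 j i j)).
- apply: etrans (hecke_epsB _ _) _; apply/eqP; rewrite subr_eq0; apply/eqP.
  exact: etrans (e2 i j) (esym (e2 j i)).
rewrite hecke_eps_multiplicative hecke_epsB hecke_epsZ hecke_epsX hecke_eps1.
by rewrite mulr1 subrr mul0r.
Qed.

Definition hecke := Quotient.quot (GRing.ZmodClosed.clone freealg hecke_idealb _).
HB.instance Definition _ := GRing.Zmodule.on hecke.

Local Open Scope quotient_scope.

Definition hecke_pi (x : freealg) : hecke := \pi_hecke x.

Fact hecke_pi_eq x y : hecke_pi x = hecke_pi y <-> hecke_ideal (x - y).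
Proof.
rewrite /hecke_pi; split=> [/eqP|h]; last apply/eqP.
  by rewrite -Quotient.idealrBE => /asboolP.
by rewrite -Quotient.idealrBE; apply/asboolP.
Qed.
Fact hecke_pi_surj u : {x | u = hecke_pi x}.
Proof. by exists (generic_quotient.repr u); rewrite /hecke_pi generic_quotient.reprK. Qed.
Fact hecke_piD x y : hecke_pi (x + y) = hecke_pi x + hecke_pi y.
Proof. exact: Quotient.pi_add. Qed.
Fact hecke_pi_repr x : hecke_ideal (x - generic_quotient.repr (hecke_pi x)).
Proof. by apply/hecke_pi_eq; rewrite /hecke_pi generic_quotient.reprK. Qed.

Definition hecke_mul (u v : hecke) : hecke := hecke_pi (generic_quotient.repr u * generic_quotient.repr v).
Definition hecke_scale (a : K) (u : hecke) : hecke := hecke_pi (a *: generic_quotient.repr u).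

Fact hecke_piM x y : hecke_pi (x * y) = hecke_mul (hecke_pi x) (hecke_pi y).
Proof.
apply/hecke_pi_eq; set x' := generic_quotient.repr _.
set y' := generic_quotient.repr (hecke_pi y).
have -> : x * y - x' * y' = x * (y - y') + (x - x') * y'.
  by rewrite mulrBr mulrBl addrA subrK.
by constructor; [apply: hecke_idealMl | apply: hecke_idealMr]; apply: hecke_pi_repr.
Qed.
Fact hecke_piZ a x : hecke_pi (a *: x) = hecke_scale a (hecke_pi x).
Proof.
apply/hecke_pi_eq; set x' := generic_quotient.repr _.
have -> : a *: x - a *: x' = a%:A * (x - x').
  by rewrite -scalerAl mul1r scalerBr.
exact/hecke_idealMl/hecke_pi_repr.
Qed.

Fact hecke_mulA : associative hecke_mul.
Proof.
move=> u v w; have [[[x ->] [y ->]] [z ->]] := (hecke_pi_surj u, hecke_pi_surj v, hecke_pi_surj w).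
by rewrite -!hecke_piM mulrA.
Qed.
Fact hecke_mul1 : left_id (hecke_pi 1) hecke_mul.
Proof. by move=> u; have [x ->] := hecke_pi_surj u; rewrite -hecke_piM mul1r. Qed.
Fact hecke_mulr1 : right_id (hecke_pi 1) hecke_mul.
Proof. by move=> u; have [x ->] := hecke_pi_surj u; rewrite -hecke_piM mulr1. Qed.
Fact hecke_mulDl : left_distributive hecke_mul +%R.
Proof.
move=> u v w; have [[[x ->] [y ->]] [z ->]] := (hecke_pi_surj u, hecke_pi_surj v, hecke_pi_surj w).
by rewrite -hecke_piD -!hecke_piM -hecke_piD mulrDl.
Qed.
Fact hecke_mulDr : right_distributive hecke_mul +%R.
Proof.
move=> u v w; have [[[x ->] [y ->]] [z ->]] := (hecke_pi_surj u, hecke_pi_surj v, hecke_pi_surj w).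
by rewrite -hecke_piD -!hecke_piM -hecke_piD mulrDr.
Qed.
Fact hecke_pi0 : hecke_pi 0 = 0.
Proof. by apply: (addrI (hecke_pi 0)); rewrite -hecke_piD !addr0. Qed.
Fact hecke_one_neq0 : hecke_pi 1 != 0.
Proof.
apply/eqP; rewrite -hecke_pi0 => /hecke_pi_eq/hecke_eps_ideal; rewrite subr0 hecke_eps1 => /eqP.
by rewrite oner_eq0.
Qed.
HB.instance Definition _ :=
  GRing.Zmodule_isNzRing.Build hecke hecke_mulA hecke_mul1 hecke_mulr1 hecke_mulDl hecke_mulDr hecke_one_neq0.

Fact hecke_scaleA a b u : hecke_scale a (hecke_scale b u) = hecke_scale (a * b) u.
Proof. by have [x ->] := hecke_pi_surj u; rewrite -!hecke_piZ scalerA. Qed.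
Fact hecke_scale1 : left_id 1 hecke_scale.
Proof. by move=> u; have [x ->] := hecke_pi_surj u; rewrite -hecke_piZ scale1r. Qed.
Fact hecke_scaleDr : right_distributive hecke_scale +%R.
Proof.
move=> a u v; have [[x ->] [y ->]] := (hecke_pi_surj u, hecke_pi_surj v).
by rewrite -hecke_piD -!hecke_piZ -hecke_piD scalerDr.
Qed.
Fact hecke_scaleDl u : {morph hecke_scale^~ u : a b / a + b}.
Proof. by move=> a b; have [x ->] := hecke_pi_surj u; rewrite -!hecke_piZ -hecke_piD scalerDl. Qed.
HB.instance Definition _ :=
  GRing.Zmodule_isLmodule.Build K hecke hecke_scaleA hecke_scale1 hecke_scaleDr hecke_scaleDl.

Fact hecke_scaleAl a (u v : hecke) : a *: (u * v) = (a *: u) * v.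
Proof.
have [[x ->] [y ->]] := (hecke_pi_surj u, hecke_pi_surj v).
by rewrite /GRing.scale /GRing.mul /= -hecke_piZ -!hecke_piM -hecke_piZ scalerAl.
Qed.
HB.instance Definition _ := GRing.Lmodule_isLalgebra.Build K hecke hecke_scaleAl.

Fact free_scaleAr a (x y : freealg) : a *: (x * y) = x * (a *: y).
Proof.
have aC : a%:MP * x = x * a%:MP.
  rewrite mul_malgC malgZ_def malgM_def fgmulgU.
  by apply: eq_bigr => k _; rewrite mulm1 mulrC.
have aE (z : freealg) : a *: z = a%:MP * z by rewrite mul_malgC.
rewrite (aE y) (aE (x * y)) (mulrA x a%:MP y) -aC.
exact: (mulrA a%:MP x y).
Qed.
Fact hecke_scaleAr a (u v : hecke) : a *: (u * v) = u * (a *: v).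
Proof.
have [[x ->] [y ->]] := (hecke_pi_surj u, hecke_pi_surj v).
by rewrite /GRing.scale /GRing.mul /= -hecke_piM -!hecke_piZ -!hecke_piM free_scaleAr.
Qed.
HB.instance Definition _ := GRing.Lalgebra_isAlgebra.Build K hecke hecke_scaleAr.

End Hecke.
End HeckeAlgebra.

Definition Tgen (K : comNzRingType) (q : K) (n : nat) (i : 'I_n.-1) : hecke q n :=
  hecke_pi q (free_gen K i).

Section Restriction.
Variables (K : comNzRingType) (k : nat).

Definition restr_var (i : 'I_k.+1) : {mpoly K[k]} :=
  if unlift ord_max i is Some j then 'X_j else 0.

(* [p(x_1, ..., x_k, 0)] *)
Definition restr (p : {mpoly K[k.+1]}) : {mpoly K[k]} :=
  p \mPo [tuple restr_var i | i < k.+1].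

Lemma restrX i : restr 'X_i = restr_var i.
Proof. by rewrite /restr comp_mpolyXU -tnth_nth tnth_mktuple. Qed.

Lemma restr_var_widen (i : 'I_k) : restr_var (widen_ord (leqnSn k) i) = 'X_i.
Proof.
have -> : widen_ord (leqnSn k) i = lift ord_max i.
  by apply: val_inj; rewrite /= /bump leqNgt ltn_ord.
by rewrite /restr_var liftK.
Qed.

Lemma restr_var_max : restr_var ord_max = 0.
Proof. by rewrite /restr_var unlift_none. Qed.

Definition mnm_ext (m : 'X_{1..k}) : 'X_{1..k.+1} :=
  [multinom if unlift ord_max i is Some j then m j else 0%N | i < k.+1].

Lemma mcoeff_restr (p : {mpoly K[k.+1]}) m : (restr p)@_m = p@_(mnm_ext m).
Proof.
rewrite /restr comp_mpolyEX [in RHS](mpolyE p) !raddf_sum /=.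
apply: eq_bigr => m' _.
rewrite !mcoeffZ; congr (_ * _).
rewrite comp_mpolyX big_ord_recr /= tnth_mktuple restr_var_max.
under eq_bigr => i _ do rewrite tnth_mktuple restr_var_widen.
have -> : \prod_(i < k) 'X_i ^+ m' (widen_ord (leqnSn k) i) =
          'X_[K, [multinom m' (widen_ord (leqnSn k) i) | i < k]].
  by rewrite [RHS]mpolyXE_id; apply: eq_bigr => i _; rewrite mnmE.
rewrite mcoeffX.
have widenE (i : 'I_k) : widen_ord (leqnSn k) i = lift ord_max i.
  by apply: val_inj; rewrite /= /bump leqNgt ltn_ord.
have [m0|m0] := posnP (m' ord_max).
  rewrite m0 expr0 mulr1 mcoeffX; congr (_ : bool)%:R.
  apply/eqP/eqP => [<-|->]; apply/mnmP => i; rewrite !mnmE.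
    case: unliftP => [j ->|->]; by rewrite ?mnmE ?widenE.
  by rewrite widenE liftK.
rewrite expr0n gtn_eqF // mulr0 mcoeff0; case: eqP => // e.
by rewrite e mnmE unlift_none in m0.
Qed.

End Restriction.

Module Export SymmetricFunctions.
Section SymFun.
Variable K : comNzRingType.

(* The inverse limit, in the category of graded rings, of the rings of symmetric
   polynomials in [k] variables along [x_(k+1) |-> 0]. *)
Definition is_symfun (f : forall k, {mpoly K[k]}) : Prop :=
  [/\ forall k, f k \is symmetric,
      forall k, restr (f k.+1) = f k &
      exists d, forall k, (msize (f k) <= d)%N].

Record symfun := SymFun {
  sfpoly :> forall k, {mpoly K[k]};
  sfpolyP : is_symfun sfpoly
}.

HB.instance Definition _ := gen_eqMixin symfun.
HB.instance Definition _ := gen_choiceMixin symfun.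

Lemma symfunP (f g : symfun) : (forall k, f k = g k) -> f = g.
Proof.
case: f g => [f fP] [g gP] /= fg.
have e : f = g by apply: functional_extensionality_dep.
by subst g; congr SymFun; apply: Prop_irrelevance.
Qed.

Fact sfzero_subproof : is_symfun (fun k => 0).
Proof.
split=> [k|k|]; [exact: rpred0 | exact: raddf0 |].
by exists 0%N => k; rewrite msize0.
Qed.
Definition sfzero := SymFun sfzero_subproof.

Fact sfone_subproof : is_symfun (fun k => 1).
Proof.
split=> [k|k|]; [exact: rpred1 | exact: rmorph1 |].
by exists 1%N => k; rewrite msize1.
Qed.
Definition sfone := SymFun sfone_subproof.

Fact sfopp_subproof (f : symfun) : is_symfun (fun k => - f k).
Proof.
case: (sfpolyP f) => fs fr [d fd]; split=> [k|k|]; first by rewrite rpredN fs.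
  by rewrite /restr raddfN /= -/(restr _) fr.
by exists d => k; rewrite msizeN.
Qed.
Definition sfopp f := SymFun (sfopp_subproof f).

Fact sfadd_subproof (f g : symfun) : is_symfun (fun k => f k + g k).
Proof.
case: (sfpolyP f) (sfpolyP g) => fs fr [d fd] [gs gr [e ge]].
split=> [k|k|]; first by rewrite rpredD ?fs ?gs.
  by rewrite /restr raddfD /= -!/(restr _) fr gr.
exists (maxn d e) => k; apply: leq_trans (msizeD_le _ _) _.
by rewrite geq_max !leq_max fd ge orbT.
Qed.
Definition sfadd f g := SymFun (sfadd_subproof f g).

Fact sfmul_subproof (f g : symfun) : is_symfun (fun k => f k * g k).
Proof.
case: (sfpolyP f) (sfpolyP g) => fs fr [d fd] [gs gr [e ge]].
split=> [k|k|]; first by rewrite rpredM ?fs ?gs.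
  by rewrite /restr rmorphM /= -!/(restr _) fr gr.
exists (d + e).+1 => k; apply: leq_trans (msizeM_le _ _) _.
by rewrite ltnS leq_add.
Qed.
Definition sfmul f g := SymFun (sfmul_subproof f g).

Fact sfscale_subproof a (f : symfun) : is_symfun (fun k => a *: f k).
Proof.
case: (sfpolyP f) => fs fr [d fd]; split=> [k|k|]; first by rewrite rpredZ ?fs.
  by rewrite /restr linearZ /= -/(restr _) fr.
by exists d => k; apply: leq_trans (msizeZ_le _ _) _.
Qed.
Definition sfscale a f := SymFun (sfscale_subproof a f).

Fact sfaddA : associative sfadd.
Proof. by move=> f g h; apply: symfunP => k /=; rewrite addrA. Qed.
Fact sfaddC : commutative sfadd.
Proof. by move=> f g; apply: symfunP => k /=; rewrite addrC. Qed.
Fact sfadd0 : left_id sfzero sfadd.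
Proof. by move=> f; apply: symfunP => k /=; rewrite add0r. Qed.
Fact sfaddN : left_inverse sfzero sfopp sfadd.
Proof. by move=> f; apply: symfunP => k /=; rewrite addNr. Qed.
HB.instance Definition _ := GRing.isZmodule.Build symfun sfaddA sfaddC sfadd0 sfaddN.

Fact sfmulA : associative sfmul.
Proof. by move=> f g h; apply: symfunP => k /=; rewrite mulrA. Qed.
Fact sfmulC : commutative sfmul.
Proof. by move=> f g; apply: symfunP => k /=; rewrite mulrC. Qed.
Fact sfmul1 : left_id sfone sfmul.
Proof. by move=> f; apply: symfunP => k /=; rewrite mul1r. Qed.
Fact sfmulDl : left_distributive sfmul +%R.
Proof. by move=> f g h; apply: symfunP => k /=; rewrite mulrDl. Qed.
Fact sfone_neq0 : sfone != 0.
Proof.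
by apply/eqP => /(congr1 (fun f : symfun => f 0%N))/eqP; rewrite oner_eq0.
Qed.
HB.instance Definition _ :=
  GRing.Zmodule_isComNzRing.Build symfun sfmulA sfmulC sfmul1 sfmulDl sfone_neq0.

Fact sfscaleA a b f : sfscale a (sfscale b f) = sfscale (a * b) f.
Proof. by apply: symfunP => k /=; rewrite scalerA. Qed.
Fact sfscale1 : left_id 1 sfscale.
Proof. by move=> f; apply: symfunP => k /=; rewrite scale1r. Qed.
Fact sfscaleDr : right_distributive sfscale +%R.
Proof. by move=> a f g; apply: symfunP => k /=; rewrite scalerDr. Qed.
Fact sfscaleDl f : {morph sfscale^~ f : a b / a + b}.
Proof. by move=> a b; apply: symfunP => k /=; rewrite scalerDl. Qed.
HB.instance Definition _ :=
  GRing.Zmodule_isLmodule.Build K symfun sfscaleA sfscale1 sfscaleDr sfscaleDl.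

Fact sfscaleAl a (f g : symfun) : a *: (f * g) = (a *: f) * g.
Proof. by apply: symfunP => k /=; rewrite scalerAl. Qed.
HB.instance Definition _ := GRing.Lmodule_isLalgebra.Build K symfun sfscaleAl.
HB.instance Definition _ := GRing.Lalgebra_isComAlgebra.Build K symfun.

Definition powersum_poly (r k : nat) : {mpoly K[k]} :=
  (\sum_(i < k) 'X_i ^+ r) *+ (0 < r)%N.

Fact powersum_subproof r : is_symfun (powersum_poly r).
Proof.
split=> [k|k|].
- apply/rpredMn/issymP => s; rewrite raddf_sum /= [RHS](reindex_inj (@perm_inj _ s)).
  apply: eq_bigr => i _; rewrite rmorphXn /=; congr (_ ^+ _).
  by rewrite /msym mmapX mmap1U.
- rewrite /restr raddfMn raddf_sum /= big_ord_recr /= !rmorphXn /=.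
  rewrite -/(restr _) restrX restr_var_max.
  case: r => [|r]; first by rewrite !mulr0n.
  rewrite expr0n addr0; congr (_ *+ _); apply: eq_bigr => i _.
  by rewrite rmorphXn /= -/(restr _) restrX restr_var_widen.
exists r.+1 => k; rewrite /powersum_poly mulrb; case: ifP => _; last by rewrite msize0.
apply: leq_trans (msize_sum _ _ _) _; apply/bigmax_leqP => i _.
by rewrite mpolyXn msizeX mdegMn mdeg1 mul1n.
Qed.

(* The power sum [p_r], for [r > 0]; there is no symmetric function [p_0] (the
   number of variables), and [powersum 0] is set to 0. *)
Definition powersum (r : nat) : symfun := SymFun (powersum_subproof r).

Definition powersums (s : seq nat) : symfun := \prod_(r <- s) powersum r.

Definition monomial_poly (s : seq nat) (k : nat) : {mpoly K[k]} :=
  \sum_(m : 'X_{1..k < (sumn s).+1} |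
        perm_eq [seq i <- (m : 'X_{1..k}) | i != 0%N] s) 'X_[m].

Lemma mcoeff_monomial_poly s k (m : 'X_{1..k}) :
  (monomial_poly s k)@_m = (perm_eq [seq i <- m | i != 0%N] s)%:R.
Proof.
rewrite /monomial_poly raddf_sum /=.
under eq_bigr => m' _ do rewrite mcoeffX.
have [ms|ms] := boolP (perm_eq _ _); last first.
  rewrite big1 // => m' m's; case: eqP => // e; by rewrite -e m's in ms.
have md : (mdeg m < (sumn s).+1)%N.
  have fE (t : seq nat) : sumn [seq i <- t | i != 0%N] = sumn t.
    by elim: t => //= -[|i] t IH //=; rewrite IH.
  by rewrite ltnS /mdeg -(perm_sumn ms) fE sumnE.
rewrite (bigD1 (BMultinom md)) //= eqxx big1 ?addr0 // => m' /andP[_ /negPf ne].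
by rewrite (ne : (bmnm m' == m) = false).
Qed.

Fact monomial_subproof s : is_symfun (monomial_poly s).
Proof.
have seqE k (m : 'X_{1..k}) : m = [seq m i | i <- enum 'I_k] :> seq nat.
  by case: m => m; rewrite -[LHS]map_tnth_enum; apply: eq_map => i; rewrite multinomE.
split=> [k|k|].
- apply/issymP => t; apply/mpolyP => m.
  rewrite mcoeff_sym !mcoeff_monomial_poly; congr (_ : bool)%:R.
  have h : perm_eq [multinom m (t i) | i < k] m.
    by apply/tuple_permP; exists t; apply: eq_map => i; rewrite /fun_of_multinom /=.
  by rewrite (permPl (perm_filter _ h)).
- apply/mpolyP => m; rewrite mcoeff_restr !mcoeff_monomial_poly.
  suff -> : mnm_ext m = rcons m 0%N :> seq nat by rewrite filter_rcons.
  rewrite [LHS]seqE enum_ordSr map_rcons mnmE unlift_none -map_comp.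
  congr rcons; rewrite [RHS]seqE; apply: eq_map => i /=; rewrite mnmE.
  have -> : widen_ord (leqnSn k) i = lift ord_max i.
    by apply: val_inj; rewrite /= /bump leqNgt ltn_ord.
  by rewrite liftK.
exists (sumn s).+1 => k.
apply: leq_trans (msize_sum _ _ _) _; apply/bigmax_leqP => m _.
by rewrite msizeX; case: m.
Qed.
Definition monomial (s : seq nat) : symfun := SymFun (monomial_subproof s).

End SymFun.
End SymmetricFunctions.

(* C(v) (x) Lambda is identified with the ring [symfun C(v)] of symmetric
   functions over C(v). *)
Section Generic.
Variable F : fieldType.

Definition ratfun : fieldType := {fraction {poly F}}.
Definition vgen : ratfun := tofrac 'X.

(* [a] is regular at [c] and takes the value [b] there. *)
Definition ratval (c : F) (a : ratfun) (b : F) : Prop :=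
  exists p r : {poly F},
    [/\ r.[c] != 0, a = tofrac p / tofrac r & b = p.[c] / r.[c]].

Definition int_laurent (a : ratfun) : Prop :=
  exists (p : {poly int}) (k : nat),
    a = tofrac (map_poly (intr : int -> F) p) / vgen ^+ k.

Definition heckev (n : nat) : algType ratfun := hecke vgen n.

Definition ZHecke : lmodType ratfun := dsum (fun n => center (heckev n)).
Definition ZSym : lmodType F := dsum (fun n => center (galg F 'S_n)).

Definition Tw n (w : 'S_n) : heckev n :=
  \prod_(i <- reduced_word w) Tgen vgen i.

Definition is_class_polys n (f : 'S_n -> intpart n -> ratfun) : Prop :=
  forall w, (forall l, int_laurent (f w l)) /\
    in_commutators (Tw w - \sum_l f w l *: Tw (wpart l)).

Definition geck_rouquier n (f : 'S_n -> intpart n -> ratfun) (l : intpart n) :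
    heckev n :=
  \sum_(w : 'S_n) (vgen ^- slength w * f w l) *: Tw w^-1%g.

(* The [Tw w] form a basis and the value in [ratval] is unique, so this is the
   graph of the partial specialization map. *)
Definition hecke_spec1 n (h : heckev n) (x : galg F 'S_n) : Prop :=
  exists a : 'S_n -> ratfun,
    h = \sum_w a w *: Tw w /\ forall w, ratval 1 (a w) (x w).

(* Likewise, with coefficients taken in the basis of the [powersums]. *)
Definition symfun_spec1 (f : symfun ratfun) (g : symfun F) : Prop :=
  exists (s : seq (seq nat)) (a : seq nat -> ratfun) (b : seq nat -> F),
    [/\ uniq s /\ all is_part s,
        f = \sum_(mu <- s) a mu *: powersums ratfun mu,
        g = \sum_(mu <- s) b mu *: powersums F mu &
        {in s, forall mu, ratval 1 (a mu) (b mu)}].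

End Generic.

(* Main.v *)
From HB Require Import structures.
Require Import Defs.
From mathcomp Require Import all_boot all_order all_fingroup all_algebra.
From mathcomp Require Import reals complex ring zify.
From mathcomp Require monalg mpoly.

Set Implicit Arguments.
Unset Strict Implicit.
Unset Printing Implicit Defensive.

Import GRing.Theory.
Local Open Scope ring_scope.

(** The theorem combines two independent computations at [v = 1].

    Class sums. The coefficient of [T_(w^-1)] in [f*_l] is [v^-l(w) f_(w,l)], so
    the first claim says that [f_(w,l)] takes at [v = 1] the value 1 when [w] has
    cycle type [l] and 0 otherwise. The congruences that define [f_(w,l)] hold
    modulo commutators over the field C(v); dividing by powers of [v - 1] is
    allowed there, so they cannot be specialized directly. They can be
    specialized after applying a trace function that is regular at [v = 1].
    The Hecke algebra acts on the [n]-th tensor power of an [n]-dimensional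
    space, with basis the words of length [n] in [n] letters, by the classical
    deformation of the place permutations ([hecke_op]), and the action preserves
    the content (the number of occurrences of each letter). So every content [m]
    gives a trace function ([word_trace]), and at [v = 1] its value on [T_w] is
    the number of words of content [m] fixed by [w]. Such a word is a colouring
    of the cycles of [w], hence this number is the coefficient of [X^m] in the
    power sum product [p_(cycle type of w)(X_1, ..., X_n)]
    ([mcoeff_fixed_words]). As [w_l] has cycle type [l] ([cycle_type_wpart]),
    specializing the congruence for [w] gives
      [p_(cycle type of w) = sum_l f_(w,l)(1) p_l],
    and the [p_l] are linearly independent in [n] variables
    ([power_product_free]).

    Frobenius map. Multiplying a monomial function [m_s] by [p_r] either adds a
    new part [r] or adds [r] to a part of [s] ([powersum_mul_monomial]):
      [p_r m_s = (mult_r(s) + 1) m_(r,s) + sum_a mult m_(s with a -> a + r)].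
    For [u_s := (v - 1)^(size s) theta(m_s)] this becomes a recursion in which
    [p_r] carries the factor [(v - 1) / (v^r - 1)], of value [1 / r], and the
    terms with a merged part, being of smaller length than [(r,s)], carry an
    extra factor [v - 1], of value 0 ([monomial_quantum_recursion]). By
    induction on the length, [u_s] specializes to [p_s / z_s]. *)

(** * The action of the Hecke algebra on words *)

Section WordRepresentation.
Import monalg.
Variables (K : comNzRingType) (q : K) (n : nat).

Local Notation word := {ffun 'I_n -> 'I_n}.

Definition word_perm (w : 'S_n) (x : word) : word := [ffun p => x (w p)].

Lemma word_perm1 x : word_perm 1 x = x.
Proof. by apply/ffunP => p; rewrite ffunE perm1. Qed.

Lemma word_permM s t x : word_perm (s * t) x = word_perm s (word_perm t x).
Proof. by apply/ffunP => p; rewrite !ffunE permM. Qed.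

Definition lpos (i : 'I_n.-1) : 'I_n := Ordinal (gen_lt i).
Definition rpos (i : 'I_n.-1) : 'I_n := Ordinal (genS_lt i).

(** The action of [T_i], written on functions of words rather than on words, so
    that no choice of a basis enters the verification of the relations. On two
    equal letters it is the multiplication by [q]. *)
Definition hecke_op (i : 'I_n.-1) (phi : word -> K) (x : word) : K :=
  if (x (rpos i) < x (lpos i))%N
  then (q - 1) * phi x + phi (word_perm (stransp i) x)
  else q * phi (word_perm (stransp i) x).

Lemma stransp_invol i x : word_perm (stransp i) (word_perm (stransp i) x) = x.
Proof. by rewrite -word_permM tperm2 word_perm1. Qed.

Lemma word_permL i x : word_perm (stransp i) x (lpos i) = x (rpos i).
Proof. by rewrite ffunE tpermL. Qed.

Lemma word_permR i x : word_perm (stransp i) x (rpos i) = x (lpos i).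
Proof. by rewrite ffunE tpermR. Qed.

Lemma word_permD i x p : p != lpos i -> p != rpos i ->
  word_perm (stransp i) x p = x p.
Proof. by move=> pl pr; rewrite ffunE tpermD // eq_sym. Qed.

Lemma word_perm_id i (x : word) : x (lpos i) = x (rpos i) -> word_perm (stransp i) x = x.
Proof.
move=> e; apply/ffunP => p; rewrite ffunE /stransp.
by case: tpermP => [->|->|] //; rewrite -/(lpos i) -/(rpos i) e.
Qed.

(** For equal letters at the places exchanged by [T_i], [phi] takes the same value
    at the word and at its permuted word; this is the eigenvalue [q]. *)
Lemma hecke_op_quad i phi x :
  hecke_op i (hecke_op i phi) x = (q - 1) * hecke_op i phi x + q * phi x.
Proof.
rewrite /hecke_op word_permL word_permR stransp_invol.
case: (ltngtP (x (rpos i)) (x (lpos i))) => [_|_|/val_inj/esym e]; try by ring.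
by rewrite word_perm_id //; ring.
Qed.

Lemma hecke_op_comm (i j : 'I_n.-1) phi x : (i.+1 < j)%N ->
  hecke_op i (hecke_op j phi) x = hecke_op j (hecke_op i phi) x.
Proof.
move=> ij.
have ne : [/\ lpos i != lpos j, lpos i != rpos j, rpos i != lpos j & rpos i != rpos j].
  by split; apply/eqP => /(congr1 val) /= e; move: ij; rewrite ?e; lia.
case: ne => ll lr rl rr.
have C : word_perm (stransp i) (word_perm (stransp j) x) =
         word_perm (stransp j) (word_perm (stransp i) x).
  rewrite -!word_permM; congr (word_perm _ x); apply/permP => p.
  rewrite !permM /stransp -!/(lpos _) -!/(rpos _).
  have [->|pl] := eqVneq p (lpos i).
    by rewrite tpermL !(tpermD (x := lpos j)) 1?eq_sym // tpermL.
  have [->|pr] := eqVneq p (rpos i).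
    by rewrite tpermR !(tpermD (x := lpos j)) 1?eq_sym // tpermR.
  rewrite (@tpermD _ (lpos i) (rpos i) p) 1?[_ == p]eq_sym //.
  by case: (tpermP (lpos j)) => *; rewrite tpermD // eq_sym.
rewrite /hecke_op !word_permD // 1?eq_sym // C.
by case: ifP; case: ifP => _ _; ring.
Qed.


(** The braid relation involves only three consecutive places: freezing the other
    letters turns it into an identity between functions of three letters, to be
    checked for each relative order of these letters. *)
Section Braid.
Variables (i j : 'I_n.-1) (ji : j = i.+1 :> nat) (x : word).

Definition update3 (u v w : 'I_n) : word :=
  [ffun p => if p == lpos i then u else if p == rpos i then v
             else if p == rpos j then w else x p].

Let rl : lpos j = rpos i. Proof. exact/val_inj. Qed.
Let lr : (rpos i == lpos i) = false.
Proof. by apply/eqP => /(congr1 val) /=; lia. Qed.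
Let ljrj : (rpos j == lpos i) = false.
Proof. by apply/eqP => /(congr1 val) /=; lia. Qed.
Let rirj : (rpos j == rpos i) = false.
Proof. by apply/eqP => /(congr1 val) /=; lia. Qed.

Lemma update3_id : update3 (x (lpos i)) (x (rpos i)) (x (rpos j)) = x.
Proof.
by apply/ffunP => p; rewrite ffunE; do 3![case: eqP => [->|_] //].
Qed.

Lemma hecke_op_l phi u v w : hecke_op i phi (update3 u v w) =
  if (v < u)%N then (q - 1) * phi (update3 u v w) + phi (update3 v u w)
  else q * phi (update3 v u w).
Proof.
have -> : update3 v u w = word_perm (stransp i) (update3 u v w).
  apply/ffunP => p; rewrite !ffunE /stransp -/(lpos i) -/(rpos i).
  case: tpermP => [->|->|/eqP/negPf -> /eqP/negPf ->]; by rewrite ?eqxx ?lr.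
by rewrite /hecke_op !ffunE !eqxx lr.
Qed.

Lemma hecke_op_r phi u v w : hecke_op j phi (update3 u v w) =
  if (w < v)%N then (q - 1) * phi (update3 u v w) + phi (update3 u w v)
  else q * phi (update3 u w v).
Proof.
have -> : update3 u w v = word_perm (stransp j) (update3 u v w).
  apply/ffunP => p; rewrite !ffunE /stransp -/(lpos j) -/(rpos j) rl.
  by case: tpermP => [->|->|/eqP/negPf -> /eqP/negPf ->];
    rewrite ?eqxx ?lr ?ljrj ?rirj ?eqxx.
by rewrite /hecke_op !ffunE rl !eqxx lr ljrj rirj.
Qed.

Lemma hecke_op_braid phi :
  hecke_op i (hecke_op j (hecke_op i phi)) x =
  hecke_op j (hecke_op i (hecke_op j phi)) x.
Proof.
rewrite -update3_id; move: (x _) (x _) (x _) => u v w.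
rewrite !(hecke_op_l, hecke_op_r).
case: (ltngtP u v) => [uv|uv|/val_inj uv]; case: (ltngtP v w) => [vw|vw|/val_inj vw];
  case: (ltngtP u w) => [uw|uw|/val_inj uw]; subst; try (exfalso; lia);
  rewrite ?ltnn; try by ring.
Qed.
End Braid.

(* A dimension in successor form, so that the matrices form a nontrivial ring. *)
Local Notation wdim := #|{: word}|.-1.+1.

Lemma wdimE : wdim = #|{: word}|.
Proof. by rewrite prednK //; apply/card_gt0P; exists [ffun p => p]. Qed.

Definition wordn (a : 'I_wdim) : word := enum_val (cast_ord wdimE a).

Lemma wordn_bij : bijective wordn.
Proof.
exists (fun x => cast_ord (esym wdimE) (enum_rank x)) => [a|x].
  by rewrite /wordn enum_valK cast_ordK.
by rewrite /wordn cast_ordKV enum_rankK.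
Qed.

(** Matrices are handled through their kernels, which are indexed by the words
    themselves. *)
Definition kernel_mx (k : word -> word -> K) : 'M[K]_wdim :=
  \matrix_(a, b) k (wordn a) (wordn b).

Lemma kernel_mx_ext k k' : (forall x y, k x y = k' x y) -> kernel_mx k = kernel_mx k'.
Proof. by move=> e; apply/matrixP => a b; rewrite !mxE e. Qed.

Lemma kernel_mxM k k' :
  kernel_mx k * kernel_mx k' = kernel_mx (fun x y => \sum_z k x z * k' z y).
Proof.
apply/matrixP => a b; rewrite !mxE (reindex wordn) /=; last exact/onW_bij/wordn_bij.
by apply: eq_bigr => c _; rewrite !mxE.
Qed.

Lemma trace_kernel_mx k : \tr (kernel_mx k) = \sum_x k x x.
Proof.
rewrite /mxtrace [RHS](reindex wordn) /=; last exact/onW_bij/wordn_bij.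
by apply: eq_bigr => a _; rewrite mxE.
Qed.

Lemma kernel_mx_surj A : exists k, A = kernel_mx k.
Proof.
have [g gK wK] := wordn_bij; exists (fun x y => A (g x) (g y)).
by apply/matrixP => a b; rewrite mxE !gK.
Qed.

Definition word_delta (y : word) : word -> K := fun x => (x == y)%:R.

Definition hecke_mx (i : 'I_n.-1) : 'M[K]_wdim :=
  kernel_mx (fun x y => hecke_op i (word_delta y) x).

Lemma hecke_op_sum i phi x :
  \sum_y hecke_op i (word_delta y) x * phi y = hecke_op i phi x.
Proof.
have S z : \sum_y (z == y)%:R * phi y = phi z.
  rewrite (bigD1 z) //= eqxx mul1r big1 ?addr0 // => y /negPf yz.
  by rewrite eq_sym yz mul0r.
rewrite /hecke_op /word_delta; case: ifP => _.
  under eq_bigr do rewrite mulrDl -mulrA.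
  by rewrite big_split /= -mulr_sumr !S.
by under eq_bigr do rewrite -mulrA; rewrite -mulr_sumr S.
Qed.

(** Left multiplication by the matrix of [T_i] is [hecke_op i] acting on the first
    variable of the kernel; products of generators thus become iterates of
    [hecke_op]. *)
Lemma hecke_mx_kernel i k :
  hecke_mx i * kernel_mx k = kernel_mx (fun x y => hecke_op i (k^~ y) x).
Proof.
by rewrite kernel_mxM; apply: kernel_mx_ext => x y; rewrite (hecke_op_sum i (k^~ y)).
Qed.

Lemma hecke_mx_quad i :
  hecke_mx i * hecke_mx i = (q - 1) *: hecke_mx i + q *: 1%:M.
Proof.
rewrite {2}/hecke_mx hecke_mx_kernel; apply/matrixP => a b.
rewrite !mxE hecke_op_quad; congr (_ + q * _).
by rewrite /word_delta (inj_eq (bij_inj wordn_bij)).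
Qed.

Definition hecke_mon (m : monalg.fmonom 'I_n.-1) : 'M[K]_wdim :=
  \prod_(i <- monalg.fmonom_val m) hecke_mx i.

Fact hecke_mon_mmorphism : monalg.mmorphism hecke_mon.
Proof.
by split=> [x y|]; rewrite /hecke_mon ?monalg.fm1 ?big_nil // monalg.fmM big_cat.
Qed.
HB.instance Definition _ :=
  monalg.isMultiplicative.Build (monalg.fmonom 'I_n.-1) 'M[K]_wdim hecke_mon hecke_mon_mmorphism.

Definition free_rep (g : freealg K n) : 'M[K]_wdim :=
  monalg.mmap (@scalar_mx K wdim) hecke_mon g.

Lemma free_repM : {morph free_rep : g h / g * h}.
Proof.
apply: (monalg.commr_mmap_is_multiplicative (f := @scalar_mx K wdim) (h := hecke_mon) _).1.
by move=> g m m'; apply: comm_scalar_mx.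
Qed.

Lemma free_rep1 : free_rep 1 = 1.
Proof. exact: monalg.mmap1. Qed.

Lemma free_repD : {morph free_rep : g h / g + h}.
Proof. exact: monalg.mmapD. Qed.

Lemma free_repB : {morph free_rep : g h / g - h}.
Proof. exact: monalg.mmapB. Qed.

Lemma free_rep0 : free_rep 0 = 0.
Proof. exact: monalg.mmap0. Qed.

Lemma free_repZ a g : free_rep (a *: g) = a%:M * free_rep g.
Proof. exact: monalg.mmapZ. Qed.

Lemma free_rep_gen i : free_rep (free_gen K i) = hecke_mx i.
Proof.
rewrite /free_rep /free_gen monalg.mmapU -[_ * _]/(_ *m _) mul1mx.
by rewrite /hecke_mon monalg.fmU big_seq1.
Qed.

Lemma free_rep_gen2 i j : free_rep (free_gen K i * free_gen K j) =
  kernel_mx (fun x y => hecke_op i (hecke_op j (word_delta y)) x).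
Proof.
apply: etrans (free_repM _ _) _.
by rewrite !free_rep_gen {2}/hecke_mx hecke_mx_kernel.
Qed.

Lemma free_rep_gen3 i j k : free_rep (free_gen K i * free_gen K j * free_gen K k) =
  kernel_mx (fun x y => hecke_op i (hecke_op j (hecke_op k (word_delta y))) x).
Proof.
apply: etrans (congr1 free_rep (esym (mulrA _ _ _))) _.
apply: etrans (free_repM _ _) _.
by rewrite free_rep_gen free_rep_gen2 hecke_mx_kernel.
Qed.

Lemma free_rep_relation r : hecke_relation q r -> free_rep r = 0.
Proof.
case=> [i|i j ji|i j ij].
- rewrite free_repM free_repB free_repD free_repZ free_rep1 free_rep_gen !mulr1.
  rewrite mulrDr mulr1 mulrBl hecke_mx_quad -[q%:M * _]/(q%:M *m _) mul_scalar_mx.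
  rewrite scalerBl scale1r scalemx1.
  have Z (V : zmodType) (A B H : V) : A - H + B - A + (H - B) = 0.
    rewrite [A - H + B - A]addrAC [A - H - A]addrAC subrr sub0r [- H + B]addrC.
    by rewrite -[B - H]opprB addNr.
  exact: Z.
- apply: etrans (free_repB _ _) _; apply/eqP; rewrite subr_eq0; apply/eqP.
  apply: etrans (free_rep_gen3 i j i) (etrans _ (esym (free_rep_gen3 j i j))).
  by apply: kernel_mx_ext => x y; apply: hecke_op_braid.
- apply: etrans (free_repB _ _) _; apply/eqP; rewrite subr_eq0; apply/eqP.
  apply: etrans (free_rep_gen2 i j) (etrans _ (esym (free_rep_gen2 j i))).
  by apply: kernel_mx_ext => x y; apply: hecke_op_comm.
Qed.

Lemma free_rep_ideal g : hecke_ideal q g -> free_rep g = 0.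
Proof.
elim=> [|g1 g2 _ h1 _ h2|g1 r g2 h]; first exact: free_rep0.
  by rewrite free_repD h1 h2 addr0.
apply: etrans (free_repM _ _) _.
apply: etrans (congr1 (fun A => A * _) (free_repM _ _)) _.
by rewrite (free_rep_relation h) mulr0 mul0r.
Qed.

Definition hecke_rep (u : hecke q n) : 'M[K]_wdim :=
  free_rep (projT1 (hecke_pi_surj u)).

Lemma hecke_rep_pi g : hecke_rep (hecke_pi q g) = free_rep g.
Proof.
rewrite /hecke_rep; case: hecke_pi_surj => h /= /hecke_pi_eq/free_rep_ideal.
by rewrite free_repB => /eqP; rewrite subr_eq0 => /eqP ->.
Qed.

Lemma hecke_repM : {morph hecke_rep : u v / u * v}.
Proof.
move=> u v; have [[g ->] [h ->]] := (hecke_pi_surj u, hecke_pi_surj v).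
by rewrite [X in hecke_rep X](esym (hecke_piM q g h)) !hecke_rep_pi free_repM.
Qed.

Lemma hecke_repD : {morph hecke_rep : u v / u + v}.
Proof.
move=> u v; have [[g ->] [h ->]] := (hecke_pi_surj u, hecke_pi_surj v).
by rewrite -hecke_piD !hecke_rep_pi free_repD.
Qed.

Lemma hecke_repZ a u : hecke_rep (a *: u) = a *: hecke_rep u.
Proof.
have [g ->] := hecke_pi_surj u.
rewrite [X in hecke_rep X](esym (hecke_piZ q a g)) !hecke_rep_pi free_repZ.
exact: mul_scalar_mx.
Qed.

Lemma hecke_rep1 : hecke_rep 1 = 1.
Proof. by rewrite [X in hecke_rep X](_ : _ = hecke_pi q 1) // hecke_rep_pi free_rep1. Qed.

Lemma hecke_rep_Tgen i : hecke_rep (Tgen q i) = hecke_mx i.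
Proof. by rewrite hecke_rep_pi free_rep_gen. Qed.

Definition word_proj (C : pred word) : 'M[K]_wdim :=
  kernel_mx (fun x y => ((x == y) && C x)%:R).

(** The predicates to be used are the words of a given content. *)
Definition perm_invariant (C : pred word) := forall w x, C (word_perm w x) = C x.

(** Each generator relates a word only to itself and to its image by a
    transposition, so the words satisfying an invariant predicate span a
    direct summand of the representation. *)
Lemma word_proj_comm C u : perm_invariant C ->
  word_proj C * hecke_rep u = hecke_rep u * word_proj C.
Proof.
move=> CP; have [g ->] := hecke_pi_surj u; rewrite hecke_rep_pi /free_rep monalg.mmapE.
rewrite mulr_suml mulr_sumr; apply: eq_bigr => m _.
have -> : word_proj C * ((monalg.mcoeff m g)%:M * hecke_mon m) =
          (monalg.mcoeff m g)%:M * (word_proj C * hecke_mon m).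
  by rewrite !mulrA; congr (_ * _); apply: comm_mx_scalar.
rewrite -mulrA; congr (_ * _); rewrite /hecke_mon.
apply: (big_ind (fun A => word_proj C * A = A * word_proj C)) => [|A B hA hB|i _].
- by rewrite mulr1 mul1r.
- by rewrite mulrA hA -mulrA hB mulrA.
rewrite hecke_mx_kernel kernel_mxM; apply: kernel_mx_ext => x y.
rewrite (bigD1 x) //= eqxx /= big1 ?addr0 => [|z /negPf zx]; last first.
  by rewrite eq_sym zx mul0r.
rewrite /hecke_op /word_delta.
have E z : C z = C x -> (C x)%:R * (z == y)%:R = ((z == y) && C z)%:R :> K.
  by move=> ->; rewrite -natrM mulnb andbC.
rewrite -!E ?CP //; case: ifP => _; ring.
Qed.

(** The trace on the direct summand spanned by the words satisfying [C]. *)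
Definition word_trace (C : pred word) (u : hecke q n) : K :=
  \tr (word_proj C * hecke_rep u).

Lemma word_traceD C : {morph word_trace C : u v / u + v}.
Proof. by move=> u v; rewrite /word_trace hecke_repD mulrDr mxtraceD. Qed.

Lemma word_traceZ C a u : word_trace C (a *: u) = a * word_trace C u.
Proof.
by rewrite /word_trace hecke_repZ -[_ * _]/(_ *m _) -scalemxAr mxtraceZ.
Qed.

Lemma word_trace0 C : word_trace C 0 = 0.
Proof. by apply: (@addIr _ (word_trace C 0)); rewrite -word_traceD !add0r. Qed.

Lemma word_trace_comb C (I : finType) (a : I -> K) (u : I -> hecke q n) :
  word_trace C (\sum_i a i *: u i) = \sum_i a i * word_trace C (u i).
Proof.
rewrite (big_morph _ (word_traceD C) (word_trace0 C)).
by apply: eq_bigr => i _; apply: word_traceZ.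
Qed.

Lemma word_traceC C u1 u2 : perm_invariant C ->
  word_trace C (u1 * u2) = word_trace C (u2 * u1).
Proof.
move=> CP; rewrite /word_trace.
apply: etrans (congr1 (fun A => \tr (word_proj C * A)) (hecke_repM u1 u2)) _.
apply: etrans _ (congr1 (fun A => \tr (word_proj C * A)) (esym (hecke_repM u2 u1))).
have := word_proj_comm u1 CP.
move: (word_proj C) (hecke_rep u1) (hecke_rep u2) => D A B DA.
by rewrite mulrA DA -mulrA -[A * _]/(A *m _) mxtrace_mulC -[_ *m A]/(_ * A) mulrA.
Qed.

Lemma word_trace_comm C u : perm_invariant C -> in_commutators u ->
  word_trace C u = 0.
Proof.
move=> CP [s ->].
elim: s => [|[u1 u2] s IH]; first by rewrite big_nil word_trace0.
rewrite big_cons word_traceD IH addr0 /=.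
rewrite -scaleN1r word_traceD word_traceZ mulN1r.
by apply/eqP; rewrite subr_eq0; apply/eqP; exact: word_traceC.
Qed.

(** What a trace function retains from a congruence modulo commutators. *)
Lemma word_trace_congr C (I : finType) (a : I -> K) (u0 : hecke q n)
    (u : I -> hecke q n) : perm_invariant C ->
  in_commutators (u0 - \sum_i a i *: u i) ->
  word_trace C u0 = \sum_i a i * word_trace C (u i).
Proof.
move=> CP /(word_trace_comm CP); rewrite -word_trace_comb.
move: (\sum_i _) => u1.
rewrite -scaleN1r word_traceD word_traceZ mulN1r => /eqP.
by rewrite subr_eq0 => /eqP.
Qed.

Lemma word_traceE C u :
  exists2 k, hecke_rep u = kernel_mx k & word_trace C u = \sum_(x | C x) k x x.
Proof.
have [k kE] := kernel_mx_surj (hecke_rep u); exists k => //.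
rewrite /word_trace kE kernel_mxM trace_kernel_mx [RHS]big_mkcond.
apply: eq_bigr => x _; rewrite (bigD1 x) //= eqxx /= big1 ?addr0 => [|z /negPf zx].
  by case: (C x); rewrite ?mul1r ?mul0r.
by rewrite eq_sym zx mul0r.
Qed.

End WordRepresentation.

(** * Values of rational functions at a point *)

(** The functions regular at [c] form a ring on which the value at [c] is
    well defined. The fraction field enters only as a field that receives an
    injective morphism from the polynomials. *)
Section RegularFractions.
Variables (F K : fieldType) (t : {rmorphism {poly F} -> K}) (t_inj : injective t) (c : F).

Definition frac_val (a : K) (b : F) : Prop :=
  exists p r : {poly F}, [/\ r.[c] != 0, a = t p / t r & b = p.[c] / r.[c]].

Lemma frac_den_neq0 (r : {poly F}) : r.[c] != 0 -> t r != 0.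
Proof.
by apply: contraNneq => /eqP; rewrite -(rmorph0 t) (inj_eq t_inj) => /eqP ->; rewrite horner0.
Qed.

Lemma frac_val_poly (p : {poly F}) : frac_val (t p) p.[c].
Proof. by exists p, 1; rewrite rmorph1 hornerC oner_eq0 !divr1. Qed.

Lemma frac_valD a a' b b' :
  frac_val a b -> frac_val a' b' -> frac_val (a + a') (b + b').
Proof.
move=> [p [r [rc -> ->]]] [p' [r' [rc' -> ->]]].
exists (p * r' + p' * r), (r * r'); split; first by rewrite hornerM mulf_neq0.
  by rewrite rmorphM rmorphD !rmorphM addf_div ?frac_den_neq0.
by rewrite hornerM hornerD !hornerM addf_div.
Qed.

Lemma frac_valM a a' b b' :
  frac_val a b -> frac_val a' b' -> frac_val (a * a') (b * b').
Proof.
move=> [p [r [rc -> ->]]] [p' [r' [rc' -> ->]]].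
exists (p * p'), (r * r'); split; first by rewrite hornerM mulf_neq0.
  by rewrite !rmorphM mulf_div.
by rewrite !hornerM mulf_div.
Qed.

Lemma frac_valV a b : b != 0 -> frac_val a b -> frac_val a^-1 b^-1.
Proof.
move=> b0 [p [r [rc -> bE]]]; exists r, p; split; last by rewrite bE invf_div.
  by move: b0; rewrite bE mulf_eq0 negb_or => /andP[].
by rewrite invf_div.
Qed.

Lemma frac_val_uniq a b b' : frac_val a b -> frac_val a b' -> b = b'.
Proof.
move=> [p [r [rc -> ->]]] [p' [r' [rc' e ->]]].
move/eqP: e; rewrite eqr_div ?frac_den_neq0 // -!rmorphM (inj_eq t_inj).
move=> /eqP/(congr1 (horner^~ c)); rewrite !hornerM => e.
by apply/eqP; rewrite eqr_div // e.
Qed.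

End RegularFractions.

Section Regular.
Variables (F : fieldType) (c : F).
Implicit Types (a : ratfun F) (b : F).

Fact tofrac_poly_inj : injective (@tofrac {poly F}).
Proof. by move=> p r /eqP; rewrite tofrac_eq => /eqP. Qed.

Lemma ratval_poly (p : {poly F}) : ratval c (tofrac p) p.[c].
Proof. exact: (frac_val_poly (@tofrac {poly F})). Qed.

Lemma ratvalD a a' b b' : ratval c a b -> ratval c a' b' -> ratval c (a + a') (b + b').
Proof. exact: (@frac_valD _ _ (@tofrac {poly F}) tofrac_poly_inj). Qed.

Lemma ratvalM a a' b b' : ratval c a b -> ratval c a' b' -> ratval c (a * a') (b * b').
Proof. exact: (@frac_valM _ _ (@tofrac {poly F})). Qed.

Lemma ratvalV a b : b != 0 -> ratval c a b -> ratval c a^-1 b^-1.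
Proof. exact: (@frac_valV _ _ (@tofrac {poly F})). Qed.

Lemma ratval_uniq a b b' : ratval c a b -> ratval c a b' -> b = b'.
Proof. exact: (@frac_val_uniq _ _ (@tofrac {poly F}) tofrac_poly_inj). Qed.

Lemma ratval0 : ratval c 0 0.
Proof. by have := ratval_poly 0; rewrite tofrac0 horner0. Qed.

Lemma ratval1 : ratval c 1 1.
Proof. by have := ratval_poly 1; rewrite tofrac1 hornerC. Qed.

Lemma ratval_vgen : ratval c (vgen F) c.
Proof. by have := ratval_poly 'X; rewrite hornerX. Qed.

Lemma ratval_const b : ratval c (tofrac b%:P) b.
Proof. by have := ratval_poly b%:P; rewrite hornerC. Qed.

Lemma ratvalX a b k : ratval c a b -> ratval c (a ^+ k) (b ^+ k).
Proof.
move=> ab; elim: k => [|k IH]; first by rewrite !expr0; exact: ratval1.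
by rewrite !exprS; apply: ratvalM.
Qed.

Lemma ratval_sum (I : Type) (s : seq I) (P : pred I) (a : I -> ratfun F) (b : I -> F) :
  (forall i, ratval c (a i) (b i)) ->
  ratval c (\sum_(i <- s | P i) a i) (\sum_(i <- s | P i) b i).
Proof.
move=> ab; elim/big_rec2: _ => [|i x y _ h]; first exact: ratval0.
exact: ratvalD.
Qed.

Lemma ratval_nat k : ratval c k%:R k%:R.
Proof.
elim: k => [|k IH]; first exact: ratval0.
by rewrite -[k.+1]addn1 !natrD; apply: ratvalD => //; exact: ratval1.
Qed.

Lemma ratvalN a b : ratval c a b -> ratval c (- a) (- b).
Proof.
move=> ab; rewrite -mulN1r -[- b]mulN1r; apply: ratvalM => //.
by have := ratval_const (- 1); rewrite polyCN tofracN tofrac1.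
Qed.

Lemma int_laurent_regular a : c != 0 -> int_laurent a -> exists b, ratval c a b.
Proof.
move=> c0 [p [k ->]]; exists ((map_poly intr p).[c] / c ^+ k).
apply: ratvalM; first exact: ratval_poly.
by apply: ratvalV; [rewrite expf_neq0 | apply/ratvalX/ratval_vgen].
Qed.

End Regular.

Section HeckeTraceSpecialization.
Variables (F : fieldType) (n : nat).
Local Notation word := {ffun 'I_n -> 'I_n}.

(** At [v = 1] the factor [v - 1] disappears from [hecke_op], and a product of
    generators becomes the place permutation of the corresponding product of
    transpositions. *)
Lemma hecke_rep_sword_spec1 (s : seq 'I_n.-1) :
  exists2 k : word -> word -> ratfun F,
    hecke_rep (\prod_(i <- s) Tgen (vgen F) i) = kernel_mx k &
    forall x y, ratval 1 (k x y) (x == word_perm (sword s) y)%:R.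
Proof.
elim: s => [|i s [k kE kv]].
  exists (fun x y => (x == y)%:R).
    rewrite big_nil hecke_rep1; apply/matrixP => a b.
    by rewrite !mxE (inj_eq (bij_inj (wordn_bij n))).
  by move=> x y; rewrite /sword big_nil word_perm1; apply: ratval_nat.
exists (fun x y => hecke_op (vgen F) i (k^~ y) x).
  rewrite big_cons; apply: etrans (hecke_repM _ _) _.
  by rewrite hecke_rep_Tgen kE hecke_mx_kernel.
move=> x y; rewrite /sword big_cons -/(sword s) word_permM /hecke_op.
have -> : (x == word_perm (stransp i) (word_perm (sword s) y)) =
          (word_perm (stransp i) x == word_perm (sword s) y).
  by apply/eqP/eqP => [->|<-]; rewrite stransp_invol.
set X := word_perm (stransp i) x; set b := (_ == _)%:R.
have v1 := ratval_vgen (1 : F).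
case: ifP => _; last by rewrite -[b]mul1r; apply: ratvalM.
rewrite -[b]add0r; apply: ratvalD => //.
rewrite -(mul0r (x == word_perm (sword s) y)%:R) -(subrr 1); apply: ratvalM => //.
by apply: ratvalD => //; apply/ratvalN/ratval1.
Qed.

Lemma word_trace_Tw_spec1 (C : pred word) (w : 'S_n) :
  ratval 1 (word_trace (q := vgen F) C (Tw F w))
           #|[pred x | C x & word_perm w x == x]|%:R.
Proof.
have [k kE kv] := hecke_rep_sword_spec1 (reduced_word w).
have -> : word_trace C (Tw F w) = \sum_(x | C x) k x x.
  have [k' k'E ->] := word_traceE C (Tw F w).
  apply: eq_bigr => x _.
  have [g gK wK] := wordn_bij n.
  by move: k'E; rewrite kE => /matrixP/(_ (g x) (g x)); rewrite !mxE wK.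
rewrite -sum1_card natr_sum big_mkcondr /=.
under [X in ratval _ _ X]eq_bigr => x _ do
  rewrite -[if _ then _ else _]/(if word_perm w x == x then 1%:R else 0%:R) -mulrb eq_sym.
apply: ratval_sum => x; have := kv x x; rewrite reduced_wordP.
by case: eqP.
Qed.

(** The trace identity between elements [T_w] has all its terms regular at 1, so
    its value at 1 is an identity between numbers of fixed words. *)
Lemma class_polys_fixed (f : 'S_n -> intpart n -> ratfun F) (C : pred word) w
    (phi : intpart n -> F) :
  is_class_polys f -> perm_invariant C -> (forall l, ratval 1 (f w l) (phi l)) ->
  #|[pred x | C x & word_perm w x == x]|%:R =
  \sum_l phi l * #|[pred x | C x & word_perm (wpart l) x == x]|%:R.
Proof.
move=> fP CP fphi; have [_ /(word_trace_congr CP) E] := fP w.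
apply: ratval_uniq (word_trace_Tw_spec1 C w) _; rewrite E.
apply: ratval_sum => l; apply: ratvalM => //; exact: word_trace_Tw_spec1.
Qed.

End HeckeTraceSpecialization.

(** * Cycle types, words fixed by a permutation, and power sums *)

Section CycleTypes.
Variable n : nat.
Implicit Types (w : 'S_n) (l : intpart n).

Lemma is_part_cycle_type w : is_part (cycle_type w).
Proof.
rewrite /is_part sort_sorted /=; last by move=> a b; apply: leq_total.
rewrite mem_sort; apply/mapP => -[c]; rewrite mem_enum => /imsetP[x _ ->] /esym/eqP.
exact/negP/card_porbit_neq0.
Qed.

Lemma sumn_cycle_type w : sumn (cycle_type w) = n.
Proof.
have pe : perm_eq (cycle_type w) [seq #|(c : {set 'I_n})| | c <- enum (porbits w)].
  by rewrite /cycle_type perm_sort.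
rewrite (perm_sumn pe) sumnE big_map big_enum /=.
rewrite -[RHS]card_ord -[in RHS]cardsT.
rewrite (@card_partition _ (porbits w)) //; apply/and3P; split.
- apply/eqP/setP => x; rewrite inE; apply/bigcupP.
  by exists (porbit w x); [apply: imset_f | apply: porbit_id].
- apply/trivIsetP => _ _ /imsetP[x _ ->] /imsetP[y _ ->] ne.
  rewrite -setI_eq0; apply/eqP/setP => z; rewrite !inE; apply/andP => -[zx zy].
  move: ne; have := zx; have := zy; rewrite -!eq_porbit_mem => /eqP <- /eqP <-.
  by rewrite eqxx.
- by apply/imsetP => -[x _ e]; have := porbit_id w x; rewrite -e inE.
Qed.

Lemma cycle_typeV w : cycle_type w^-1 = cycle_type w.
Proof. by rewrite /cycle_type porbitsV. Qed.

Lemma parts_inj : injective (@parts n).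
Proof.
move=> l l' /(inj_map val_inj) e; apply/val_inj/val_inj; exact: e.
Qed.

Lemma cycle_type_part w : exists l, parts l = cycle_type w.
Proof. exact: intpart_complete (is_part_cycle_type w) (sumn_cycle_type w). Qed.

End CycleTypes.

Section WordContents.
Import mpoly.
Variables (R : comNzRingType) (n : nat).
Local Notation word := {ffun 'I_n -> 'I_n}.

Definition power_product k (s : seq nat) : {mpoly R[k]} :=
  \prod_(r <- s) \sum_(i < k) 'X_i ^+ r.

Definition content (x : word) : 'X_{1..n} := (\sum_p U_(x p))%MM.

Lemma content_perm w x : content (word_perm w x) = content x.
Proof.
rewrite /content [RHS](reindex_inj (@perm_inj _ w)).
by apply: eq_bigr => p _; rewrite ffunE.
Qed.

Lemma fixed_word_porbit w (x : word) p p' :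
  word_perm w x = x -> p' \in porbit w p -> x p' = x p.
Proof.
move=> xw /porbitP[k ->]; elim: k => [|k IH]; first by rewrite expg0 perm1.
by rewrite expgSr permM -IH -[in RHS]xw ffunE.
Qed.

(** A word fixed by [w] is constant on the cycles of [w], so it amounts to the
    choice of one letter for each cycle; a cycle of length [r] contributes the
    sum of the [X_i ^ r]. *)
Lemma sum_fixed_words w :
  \sum_(x : word | word_perm w x == x) 'X_[content x] = power_product n (cycle_type w).
Proof.
have -> : power_product n (cycle_type w) = \prod_(c in porbits w) \sum_(i < n) 'X_i ^+ #|c|.
  rewrite /power_product /cycle_type.
  by rewrite (perm_big _ (permEl (perm_sort _ _))) big_map big_enum.
rewrite [RHS]big_sub bigA_distr_bigA.
pose orb (p : 'I_n) : {c in porbits w} := exist _ (porbit w p) (imset_f _ isT).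
have orb_ex (c : {c in porbits w}) : exists p, orb p == c.
  by case: c => c /= cw; have /imsetP[p _ e] := cw; exists p; rewrite -val_eqE /= e.
pose elt c := xchoose (orb_ex c).
have eltK c : orb (elt c) = c by apply/eqP/(xchooseP (orb_ex c)).
pose h (g : {ffun {c in porbits w} -> 'I_n}) : word := [ffun p => g (orb p)].
pose h' (x : word) : {ffun {c in porbits w} -> 'I_n} := [ffun c => x (elt c)].
rewrite (reindex_onto h h') => [|x /eqP xw]; last first.
  apply/ffunP => p; rewrite !ffunE; apply: fixed_word_porbit xw _.
  by rewrite -eq_porbit_mem; have /(congr1 val)/= -> := eltK (orb p).
apply: eq_big => [g|g _]; last first.
  rewrite /content (big_morph (fun m => 'X_[R, m]) (@mpolyXD _ _) (mpolyX0 _ _)).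
  rewrite (partition_big orb xpredT) //=; apply: eq_bigr => c _.
  rewrite (eq_bigr (fun=> 'X_(g c))) => [|p /eqP <-]; last by rewrite ffunE.
  rewrite prodr_const; congr (_ ^+ _); apply: eq_card => p.
  rewrite -{2}(eltK c) /= -eq_porbit_mem -[LHS]/(orb p == c) -val_eqE /=.
  by have /(congr1 val)/= -> := eltK c.
apply/andP; split; apply/eqP/ffunP => p; rewrite !ffunE ?eltK //.
congr (g _); apply/val_inj/eqP; rewrite /= eq_porbit_mem.
exact: (mem_porbit w 1 p).
Qed.

Lemma mcoeff_fixed_words w (m : 'X_{1..n}) :
  #|[pred x : word | content x == m & word_perm w x == x]|%:R =
  (power_product n (cycle_type w))@_m :> R.
Proof.
rewrite -sum_fixed_words raddf_sum -sum1_card natr_sum /=.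
rewrite (eq_bigl (fun x => (word_perm w x == x) && (content x == m))) => [|x]; last exact: andbC.
rewrite big_mkcondr; apply: eq_bigr => x _; rewrite mcoeffX; by case: eqP.
Qed.

(** The elementary step of all computations with coefficients below. *)
Lemma mcoeff_mulXn k (i : 'I_k) r (p : {mpoly R[k]}) m :
  ('X_i ^+ r * p)@_m = if (r <= m i)%N then p@_(m - U_(i) *+ r)%MM else 0.
Proof.
have XE : 'X_i ^+ r = 'X_[R, U_(i) *+ r] by rewrite mpolyXn.
have le : (U_(i) *+ r <= m)%MM = (r <= m i)%N.
  apply/mnm_lepP/idP => [/(_ i)|rm j]; first by rewrite mulmnE mnm1E eqxx mul1n.
  by rewrite mulmnE mnm1E; case: eqP => [<-|_]; rewrite ?mul1n ?mul0n.
case: ifP => rm; first by rewrite mulrC XE -{1}(submK (m' := m) (m := U_(i) *+ r)) ?le //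
  [X in _@_X]addmC mcoeffMX.
rewrite mulrC XE [p]mpolyE mulr_suml raddf_sum big1 // => m' _ /=.
rewrite -scalerAl mcoeffZ -mpolyXD mcoeffX; case: eqP => [e|]; last by rewrite mulr0.
by move: rm; rewrite -le -e lem_addl.
Qed.

End WordContents.

Section PowerProductIndependence.
Import mpoly Num.Theory.
Variable (K : numFieldType).

Definition exponents k (m : 'X_{1..k}) : seq nat := [seq r <- m | r != 0%N].


(** [t] lists the nonzero exponents of the variables other than [X_i]. *)
Lemma exponentsP k (m : 'X_{1..k}) (i : 'I_k) :
  exists2 t, 0%N \notin t & forall m' : 'X_{1..k}, (forall j, j != i -> m' j = m j) ->
    perm_eq (exponents m') [seq r <- m' i :: t | r != 0%N].
Proof.
exists [seq r <- [seq m j | j <- enum 'I_k & j != i] | r != 0%N].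
  by rewrite mem_filter eqxx.
move=> m' mm'; rewrite /exponents.
have -> : m' = [seq m' j | j <- enum 'I_k] :> seq nat.
  by case: m' {mm'} => m'; rewrite -[LHS]map_tnth_enum; apply: eq_map => j; rewrite multinomE.
have pe : perm_eq (enum 'I_k) (i :: [seq j <- enum 'I_k | j != i]).
  rewrite (perm_trans (perm_to_rem (mem_enum _ i))) // perm_cons.
  by rewrite rem_filter ?enum_uniq.
rewrite (perm_trans (perm_filter _ (perm_map _ pe))) //= filter_id.
suff -> : [seq m' j | j <- enum 'I_k & j != i] = [seq m j | j <- enum 'I_k & j != i] by [].
by apply/eq_in_map => j; rewrite mem_filter => /andP[ji _]; rewrite mm'.
Qed.

Lemma exponents_eq0 k (m : 'X_{1..k}) : exponents m = [::] -> m = 0%MM.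
Proof.
move=> e; apply/mnmP => i; rewrite mnm0E.
have [t _ /(_ m (fun _ _ => erefl))] := exponentsP m i.
by rewrite e /=; case: eqP => // _ /perm_size.
Qed.

Lemma mem_exponents k (m : 'X_{1..k}) r : r \in exponents m -> exists i, m i = r.
Proof.
rewrite mem_filter => /andP[_ rm]; have [i ri e] : exists2 i, (i < k)%N & nth 0%N m i = r.
  by case/(nthP 0%N): rm => i; rewrite size_tuple => ik e; exists i.
by exists (Ordinal ri); rewrite -e /fun_of_multinom (tnth_nth 0%N).
Qed.

Lemma exponents0 k : exponents (0%MM : 'X_{1..k}) = [::].
Proof.
case E : exponents => [|a t] //; have h : a \in exponents (0%MM : 'X_{1..k}).
  by rewrite E mem_head.
by case: (mem_exponents h) => i; rewrite mnm0E => e; move: h; rewrite -e mem_filter.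
Qed.

Lemma exponents_sub k (m : 'X_{1..k}) (i : 'I_k) r : (0 < r <= m i)%N ->
  exists t, [/\ 0%N \notin t, perm_eq (exponents m) (m i :: t) &
    perm_eq (exponents (m - U_(i) *+ r)%MM)
            (if m i == r then t else (m i - r)%N :: t)].
Proof.
move=> /andP[r0 rm]; have [t t0 tP] := exponentsP m i; exists t.
have ft : [seq r <- t | r != 0%N] = t.
  by apply/all_filterP/allP => a at_; apply: contraNneq t0 => <-.
split=> //; first by have /= := tP m (fun _ _ => erefl); rewrite ft -lt0n (leq_trans r0 rm).
have /= := tP (m - U_(i) *+ r)%MM; rewrite ft mnmBE mulmnE mnm1E eqxx mul1n.
rewrite subn_eq0 eqn_leq rm andbT; case: leqP => /= _; apply=> j ji;
  by rewrite mnmBE mulmnE mnm1E eq_sym (negPf ji) subn0.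
Qed.

Lemma mcoeff_power_product_cons k r s (m : 'X_{1..k}) :
  (power_product K k (r :: s))@_m =
  \sum_(i < k | (r <= m i)%N) (power_product K k s)@_(m - U_(i) *+ r)%MM.
Proof.
rewrite /power_product big_cons mulr_suml raddf_sum [RHS]big_mkcond /=.
by apply: eq_bigr => i _; rewrite mcoeff_mulXn.
Qed.

(** Expanding a product of power sums merges some of its factors in the same
    variable, so its monomials have at most as many variables as the product has
    factors, with equality only when nothing is merged. *)
Lemma power_product_support k s (m : 'X_{1..k}) : 0%N \notin s ->
  (power_product K k s)@_m != 0 ->
  (size (exponents m) <= size s)%N /\
  (size (exponents m) = size s -> perm_eq (exponents m) s).
Proof.
elim: s m => [|r s IH] m.
  rewrite /power_product big_nil mcoeff1 => _; case: (m =P 0%MM) => [->|_]; last by rewrite eqxx.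
  by rewrite exponents0.
rewrite inE negb_or eq_sym -lt0n mcoeff_power_product_cons => /andP[r0 s0] nz.
have [i rm nzi] : exists2 i, (r <= m i)%N & (power_product K k s)@_(m - U_(i) *+ r)%MM != 0.
  apply/exists_inP; apply: contraNT nz => /exists_inPn h.
  by rewrite big1 // => i rm; apply/eqP; move: (h i rm); rewrite negbK.
have [szs eqs] := IH _ s0 nzi.
have [t [t0 mt]] := exponents_sub (m := m) (i := i) (r := r) (introT andP (conj r0 rm)).
rewrite (perm_size mt) /= => m't; move: szs eqs; rewrite (perm_size m't).
case: eqP m't => [mi|mi] m't /= szs eqs.
  split=> // -[sz]; rewrite (perm_trans mt) // mi perm_cons.
  by rewrite -(permPl m't) eqs.
by split; [apply: leq_trans szs _ | move=> [sz]; rewrite sz ltnn in szs].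
Qed.

Lemma power_product_ge0 k s (m : 'X_{1..k}) : 0 <= (power_product K k s)@_m.
Proof.
elim: s m => [|r s IH] m; first by rewrite /power_product big_nil mcoeff1 ler0n.
by rewrite mcoeff_power_product_cons sumr_ge0.
Qed.

(** All coefficients are nonnegative, so the contribution of the monomial that
    gives each factor a variable of its own cannot cancel. *)
Lemma power_product_gt0 k s (m : 'X_{1..k}) : 0%N \notin s ->
  perm_eq (exponents m) s -> 0 < (power_product K k s)@_m.
Proof.
elim: s m => [|r s IH] m.
  by move=> _ /perm_nilP/exponents_eq0 ->; rewrite /power_product big_nil mcoeff1 eqxx ltr01.
rewrite inE negb_or eq_sym -lt0n => /andP[r0 s0] ms.
have [i mi] : exists i, m i = r by apply: mem_exponents; rewrite (perm_mem ms) mem_head.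
rewrite mcoeff_power_product_cons (bigD1 i) ?mi //=.
apply: ltr_wpDr; first by apply: sumr_ge0 => j _; apply: power_product_ge0.
have [|t [t0 mt]] := exponents_sub (m := m) (i := i) (r := r); first by rewrite r0 mi /=.
rewrite mi eqxx => m't; apply: IH => //.
by rewrite (permPl m't) -(perm_cons r) -[in X in perm_eq X]mi -(permPl mt).
Qed.

Lemma parts_mnm n (l : intpart n) : exists m : 'X_{1..n}, exponents m = parts l.
Proof.
have sz : (size (parts l) <= n)%N by rewrite size_map; apply: (valP (intpart_bseq l)).
have szE : size (parts l ++ nseq (n - size (parts l)) 0%N) == n.
  by rewrite size_cat size_nseq subnKC.
exists (Multinom (Tuple szE)); rewrite /exponents /= filter_cat filter_nseq /= cats0.
apply/all_filterP/allP => a al; have /andP[_ z] := parts_is_part l.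
by apply: contraNneq z => <-.
Qed.

(** Triangularity: among the partitions with a nonzero coefficient, take one with
    the largest number of parts. By [power_product_support] its own monomial
    occurs in no other product of the relation. *)
Lemma power_product_free n (phi : intpart n -> K) :
  (forall m, \sum_l phi l * (power_product K n (parts l))@_m = 0) ->
  forall l, phi l = 0.
Proof.
move=> H l0; apply/eqP/negPn/negP => l0nz.
pose l := [arg max_(l > l0 | phi l != 0) size (parts l)].
have [lnz lmax] : phi l != 0 /\ forall l', phi l' != 0 -> (size (parts l') <= size (parts l))%N.
  by rewrite /l; case: arg_maxnP.
have nz (l' : intpart n) : 0%N \notin parts l' by have /andP[] := parts_is_part l'.
have [m ml] := parts_mnm l; have := H m; rewrite (bigD1 l) //= big1 ?addr0.
  apply/eqP; rewrite mulf_neq0 // Order.POrderTheory.gt_eqF // power_product_gt0 ?ml //.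
move=> l' l'l; have [->|p0] := eqVneq (phi l') 0; first by rewrite mul0r.
have [->|c0] := eqVneq (power_product K n (parts l'))@_m 0; first by rewrite mulr0.
have [] := power_product_support (nz l') c0; rewrite ml => h1 h2.
have /h2 pe : size (parts l) = size (parts l') by apply/eqP; rewrite eqn_leq h1 lmax.
case/eqP: l'l; apply: parts_inj.
have /andP[s1 _] := parts_is_part l; have /andP[s2 _] := parts_is_part l'.
apply: sorted_eq s2 s1 _; last by rewrite perm_sym.
- by move=> y x z /= h h'; apply: leq_trans h' h.
- by move=> x y; rewrite /= -eqn_leq => /eqP.
Qed.

End PowerProductIndependence.

Lemma sumn_take_nth s j : (j < size s)%N ->
  (sumn (take j s) + nth 0 s j)%N = sumn (take j.+1 s).
Proof. by move=> js; rewrite (take_nth 0%N js) sumn_rcons. Qed.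

Lemma leq_sumn_take s i j : (i <= j)%N -> (sumn (take i s) <= sumn (take j s))%N.
Proof.
move=> ij; rewrite -[in X in (_ <= X)%N](cat_take_drop i (take j s)) sumn_cat.
by rewrite take_takel // leq_addr.
Qed.

Lemma sumn_take_locate s p : (p < sumn s)%N ->
  exists2 j, (j < size s)%N & (sumn (take j s) <= p < sumn (take j.+1 s))%N.
Proof.
elim: s p => [|a s IH] p //= ps.
have [pa|ap] := ltnP p a; first by exists 0%N; rewrite //= take0 /= addn0.
have [|j js /andP[h1 h2]] := IH (p - a)%N; first lia.
by exists j.+1 => //=; move: h1 h2; case: s {ps IH} js => //= b s _; lia.
Qed.

Section BlockCycles.
Variable n : nat.
Implicit Type l : intpart n.
Local Open Scope group_scope.

Lemma porbit_fcycle (w : 'S_n) (s : seq 'I_n) p :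
  fcycle w s -> p \in s -> porbit w p = [set x in s].
Proof.
move=> ws ps; apply/setP => x; rewrite inE -(fconnect_cycle ws ps).
apply/porbitP/idP => [[k ->]|xp]; first by rewrite permX fconnect_iter.
by exists (findex w p x); rewrite permX iter_findex.
Qed.

(** A product of permutations of which only one moves the points of [S] acts on
    [S] as that one, whatever the order of the factors. *)
Lemma prod_perm_local (I : eqType) (c : I -> 'S_n) (s : seq I) (i : I) (S : seq 'I_n) :
  uniq s -> (forall p, p \in S -> c i p \in S) ->
  (forall j, j != i -> {in S, forall p, c j p = p}) ->
  {in S, forall p, (\prod_(j <- s) c j) p = if i \in s then c i p else p}.
Proof.
move=> us Si cj; elim: s us => [|j s IH] /= us p pS; first by rewrite big_nil perm1.
case/andP: us => js us; rewrite big_cons permM inE.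
have [ij|ij] := eqVneq i j; last by rewrite cj ?IH // eq_sym.
by rewrite -ij IH ?Si // ij (negPf js).
Qed.

Lemma mem_block b r (p : 'I_n) : (p \in block n b r) = (b <= p < b + r)%N.
Proof. by rewrite mem_filter mem_enum andbT. Qed.

Lemma uniq_block b r : uniq (block n b r).
Proof. exact/filter_uniq/enum_uniq. Qed.

Lemma block_cycleE b r (p : 'I_n) : block_cycle n b r p = next (block n b r) p.
Proof. by rewrite permE. Qed.

Lemma size_block b r : (b + r <= n)%N -> size (block n b r) = r.
Proof.
move=> brn.
have -> : size (block n b r) = size [seq i <- iota 0 n | (b <= i < b + r)%N].
  by rewrite -val_enum_ord filter_map size_map.
rewrite -[RHS](size_iota b r); apply/perm_size/uniq_perm; rewrite ?iota_uniq //.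
  exact/filter_uniq/iota_uniq.
by move=> i; rewrite mem_filter !mem_iota; lia.
Qed.

Section Wpart.
Variable l : intpart n.
Local Notation s := (parts l).
Definition part_block (j : nat) : seq 'I_n := block n (sumn (take j s)) (nth 0%N s j).

Lemma mem_part_block j (p : 'I_n) : (j < size s)%N ->
  (p \in part_block j) = (sumn (take j s) <= p < sumn (take j.+1 s))%N.
Proof. by move=> js; rewrite mem_block sumn_take_nth. Qed.

Lemma part_block_disjoint (i j : nat) (p : 'I_n) : (i < size s)%N -> (j < size s)%N ->
  p \in part_block i -> p \in part_block j -> i = j.
Proof.
move=> il jl; rewrite !mem_part_block // => hi hj.
by case: (ltngtP i j) => // /(leq_sumn_take s); lia.
Qed.

Lemma size_part_block j : (j < size s)%N -> size (part_block j) = nth 0%N s j.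
Proof.
move=> js; apply: size_block; rewrite sumn_take_nth //.
rewrite -[X in (_ <= X)%N](sumn_parts l) -[in X in (_ <= X)%N](take_size s).
exact: leq_sumn_take.
Qed.

Lemma part_block_neq0 j : (j < size s)%N -> exists p, p \in part_block j.
Proof.
move=> js; have := size_part_block js.
case: (part_block j) => [/= z|p t _]; last by exists p; rewrite mem_head.
by have /andP[_ /negP[]] := parts_is_part l; rewrite z mem_nth.
Qed.

(** On a block, [wpart l] coincides with the cycle of that block, because the other
    factors fix the block pointwise. *)
Lemma wpart_porbit j p : (j < size s)%N -> p \in part_block j ->
  porbit (wpart l) p = [set x in part_block j].
Proof.
move=> js pj; apply: porbit_fcycle => //.
have cyc : fcycle (next (part_block j)) (part_block j) by apply/cycle_next/uniq_block.
rewrite -(eq_in_cycle (P := mem (part_block j)) (e := frel (next (part_block j)))) //.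
  move=> x y xj _ /=; congr (_ == _); rewrite /wpart.
  have := @prod_perm_local _ (fun i : 'I_(size s) => block_cycle n (sumn (take i s)) (nth 0%N s i))
    (index_enum _) (Ordinal js) (part_block j) (index_enum_uniq _).
  move=> -> //; rewrite ?mem_index_enum ?block_cycleE //.
    by move=> p' /= p'j; rewrite block_cycleE mem_next.
  move=> i ij p' p'j; rewrite block_cycleE next_nth ifN //.
  apply/negP => p'i; case/eqP: ij; apply: val_inj => /=.
  exact: part_block_disjoint p'i p'j.
Qed.

Lemma cycle_type_wpart : cycle_type (wpart l) = s.
Proof.
have pe : perm_eq (enum (porbits (wpart l)))
    [seq [set x in part_block j] | j : 'I_(size s)].
  apply: uniq_perm; first exact: enum_uniq.
    rewrite map_inj_uniq ?enum_uniq // => i j e; apply/val_inj.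
    have [p pj] := part_block_neq0 (ltn_ord j).
    apply: (part_block_disjoint (p := p) (ltn_ord i) (ltn_ord j)) => //.
    by have := congr1 (fun c : {set 'I_n} => p \in c) e; rewrite /= !inE pj.
  move=> c; rewrite mem_enum; apply/imsetP/mapP => [[p _ ->]|[j _ ->]].
    have : (p < sumn s)%N by rewrite sumn_parts.
    case/sumn_take_locate => j js h; exists (Ordinal js); first exact: mem_enum.
    by apply: wpart_porbit => //; rewrite mem_part_block.
  have [p pj] := part_block_neq0 (ltn_ord j).
  by exists p => //; rewrite (wpart_porbit _ pj).
have /andP[ss _] := parts_is_part l.
have leT : transitive geq by move=> y x z /= h h'; apply: leq_trans h' h.
have leA : antisymmetric geq by move=> x y; rewrite /= -eqn_leq => /eqP.
apply: (sorted_eq leT leA) => //; first by apply: sort_sorted => a b; apply: leq_total.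
rewrite perm_sort (permPl (perm_map _ pe)).
rewrite -[X in perm_eq _ X](mkseq_nth 0%N) /mkseq -val_enum_ord -map_comp.
suff -> : [seq #|(c : {set 'I_n})| | c <- [seq [set x in part_block j] | j : 'I_(size s)]] =
          [seq nth 0%N s (j : 'I_(size s)) | j <- enum 'I_(size s)] by [].
rewrite -map_comp; apply: eq_map => j /=.
rewrite cardsE (card_uniqP (uniq_block _ _)); exact: size_part_block.
Qed.

End Wpart.
End BlockCycles.

(** * Products of power sums and monomial functions *)

Section MonomialRecursion.
Import mpoly.
Variable K : comNzRingType.

Lemma mcoeff_monomial s k (m : 'X_{1..k}) :
  (monomial K s k)@_m = (perm_eq (exponents m) s)%:R.
Proof. exact: mcoeff_monomial_poly. Qed.

Lemma monomial_nil : monomial K [::] = 1.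
Proof.
apply: symfunP => k; apply/mpolyP => m; rewrite mcoeff_monomial.
rewrite -[sfpoly 1 k]/(1 : {mpoly K[k]}) mcoeff1; congr (_ : bool)%:R.
apply/perm_nilP/eqP => [/exponents_eq0 //|->]; exact: exponents0.
Qed.

Lemma count_exponents k (m : 'X_{1..k}) b : (0 < b)%N ->
  (\sum_(i < k) (m i == b) = count_mem b (exponents m))%N.
Proof.
move=> b0; rewrite count_filter.
have -> : count (predI (pred1 b) (fun r => r != 0%N)) m = count_mem b m.
  by apply: eq_count => r /=; case: eqP => // ->; rewrite -lt0n b0.
have -> : m = [seq m j | j <- enum 'I_k] :> seq nat.
  by case: m => m; rewrite -[LHS]map_tnth_enum; apply: eq_map => j; rewrite multinomE.
rewrite count_map -sum1_count [RHS]big_mkcond big_enum /=.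
by apply: eq_bigr => i _ /=; case: eqP.
Qed.

(** Dividing [X^m] by [X_i ^ r] either removes the variable [X_i], which is the
    case of a new part [r], or leaves it with an exponent [a > 0], which is the
    case of a part [a] of [s] enlarged to [r + a]. *)
Lemma perm_exponents_sub k (m : 'X_{1..k}) (i : 'I_k) r s : (0 < r)%N -> 0%N \notin s ->
  ((r <= m i)%N && perm_eq (exponents (m - U_(i) *+ r)%MM) s)%:R =
  ((m i == r) && perm_eq (exponents m) (r :: s))%:R +
  \sum_(a <- undup s) ((m i == r + a)%N && perm_eq (exponents m) ((r + a)%N :: rem a s))%:R :> K.
Proof.
move=> r0 s0; have [mr|rm] := ltnP (m i) r.
  rewrite (ltn_eqF mr) big1 ?addr0 // => a _.
  by rewrite ltn_eqF // (leq_trans mr) ?leq_addr.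
have [t [t0 mt]] := exponents_sub (m := m) (i := i) (r := r) (introT andP (conj r0 rm)).
rewrite /= (permPl mt); have [mi|mi] := eqVneq (m i) r => m't.
  rewrite (permPl m't) mi perm_cons big_seq big1 ?addr0 // => a.
  rewrite mem_undup -{1}[r]addn0 eqn_add2l => a_s; case: eqP => // a0.
  by rewrite a0 a_s in s0.
rewrite (permPl m't) add0r; set a0 := (m i - r)%N.
have miE : m i = (r + a0)%N by rewrite subnKC.
have E a : (m i == r + a)%N = (a == a0) by rewrite miE eqn_add2l eq_sym.
under eq_bigr => a _ do rewrite E (permPl mt).
have [a0s|a0s] := boolP (a0 \in s); last first.
  rewrite big_seq big1 => [|a]; last first.
    rewrite mem_undup => a_s; case: eqP => // e; by rewrite -e a_s in a0s.
  by case: (boolP (perm_eq _ _)) => // /perm_mem/(_ a0); rewrite mem_head (negPf a0s).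
rewrite (bigD1_seq a0) ?undup_uniq ?mem_undup //= eqxx -miE perm_cons big1 ?addr0.
  by rewrite (permPr (perm_to_rem a0s)) perm_cons.
by move=> a /negPf ->.
Qed.

Definition bump_part r (s : seq nat) a := (r + a)%N :: rem a s.

(** Summing [perm_exponents_sub] over the variables: the multiplicities count the
    variables that carry the new or enlarged part in a given monomial. *)
Lemma powersum_mul_monomial r s : (0 < r)%N -> 0%N \notin s ->
  powersum K r * monomial K s =
  (count_mem r s).+1%:R *: monomial K (r :: s) +
  \sum_(a <- undup s)
     (count_mem (r + a)%N (bump_part r s a))%:R *: monomial K (bump_part r s a).
Proof.
move=> r0 s0; apply: symfunP => k; apply/mpolyP => m.
rewrite -[sfpoly (_ * _) k]/(powersum K r k * monomial K s k).
rewrite -[sfpoly (_ + _) k]/((count_mem r s).+1%:R *: monomial K (r :: s) k +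
  sfpoly (\sum_(a <- undup s) _) k).
have -> (I : Type) (t : seq I) (f : I -> symfun K) :
    sfpoly (\sum_(a <- t) f a) k = \sum_(a <- t) f a k.
  exact: (big_morph (fun g : symfun K => g k)).
rewrite mcoeffD mcoeffZ mcoeff_monomial raddf_sum /=.
rewrite /powersum_poly r0 mulr1n mulr_suml raddf_sum /=.
transitivity (\sum_(i < k) (((m i == r) && perm_eq (exponents m) (r :: s))%:R +
  \sum_(a <- undup s) ((m i == r + a)%N && perm_eq (exponents m) ((r + a)%N :: rem a s))%:R : K)).
  apply: eq_bigr => i _; rewrite -perm_exponents_sub // mcoeff_mulXn.
  by case: ifP => //= _; rewrite mcoeff_monomial.
have C b u : (0 < b)%N -> \sum_(i < k) ((m i == b) && perm_eq (exponents m) u)%:R =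
    (count_mem b u)%:R * (perm_eq (exponents m) u)%:R :> K.
  move=> b0; case: (boolP (perm_eq _ _)) => [/seq.permP pu|_]; last first.
    by rewrite mulr0 big1 // => i _; rewrite andbF.
  by rewrite mulr1 -pu -count_exponents // natr_sum; apply: eq_bigr => i _; rewrite andbT.
rewrite big_split /= C //= eqxx add1n; congr (_ + _).
rewrite exchange_big /=; apply: eq_bigr => a _.
by rewrite C ?addn_gt0 ?r0 // mcoeffZ mcoeff_monomial.
Qed.

End MonomialRecursion.

(** Parts larger than the sum do not occur, so the range of the product may be
    enlarged; this lets the products for [s] and [r :: s] be compared. *)
Lemma zee_bound s N : (sumn s < N)%N ->
  zee s = \prod_(1 <= i < N) (i ^ count_mem i s * (count_mem i s)`!)%N.
Proof.
move=> sN; rewrite /zee [RHS](big_cat_nat (n := (sumn s).+1)) //=.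
rewrite [X in _ = (_ * X)%N]big_nat_cond [X in _ = (_ * X)%N]big1 ?muln1 // => i.
case/andP=> /andP[si _] _.
suff /count_memPn -> : i \notin s by rewrite fact0 expn0.
apply: contraL si => i_s; rewrite -leqNgt.
by rewrite (perm_sumn (perm_to_rem i_s)) /= leq_addr.
Qed.

Lemma zee_cons r s : (0 < r)%N -> zee (r :: s) = (r * (count_mem r s).+1 * zee s)%N.
Proof.
move=> r0; rewrite (@zee_bound s (sumn (r :: s)).+1) ?ltnS ?leq_addl // {1}/zee.
have rN : r \in index_iota 1 (sumn (r :: s)).+1.
  by rewrite mem_index_iota r0 ltnS leq_addr.
rewrite !(bigD1_seq r) ?iota_uniq //= eqxx add1n expnS factS.
rewrite (eq_bigr (fun i => i ^ count_mem i s * (count_mem i s)`!)%N).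
  by move: (\prod_(_ <- _ | _) _)%N (r ^ _)%N (_`!)%N => *; ring.
by move=> i /negPf ir; rewrite eq_sym ir add0n.
Qed.

(** * Specialization of symmetric functions *)

Lemma sum_undup_catl (R : pzRingType) (V : lmodType R) (I : eqType) (s1 s2 : seq I)
    (a : I -> R) (p : I -> V) : uniq s1 ->
  \sum_(i <- undup (s1 ++ s2)) (if i \in s1 then a i else 0) *: p i =
  \sum_(i <- s1) a i *: p i.
Proof.
move=> u1.
have -> : \sum_(i <- undup (s1 ++ s2)) (if i \in s1 then a i else 0) *: p i =
          \sum_(i <- undup (s1 ++ s2) | i \in s1) a i *: p i.
  by rewrite [RHS]big_mkcond; apply: eq_bigr => i _; case: ifP; rewrite ?scale0r.
rewrite -big_filter; apply: perm_big; apply: uniq_perm => //.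
  exact/filter_uniq/undup_uniq.
by move=> i; rewrite mem_filter mem_undup mem_cat; case: (i \in s1).
Qed.

Lemma sum_undup_catr (R : pzRingType) (V : lmodType R) (I : eqType) (s1 s2 : seq I)
    (a : I -> R) (p : I -> V) : uniq s2 ->
  \sum_(i <- undup (s1 ++ s2)) (if i \in s2 then a i else 0) *: p i =
  \sum_(i <- s2) a i *: p i.
Proof.
move=> /(sum_undup_catl s1 a p) <-; apply: perm_big; apply: uniq_perm; rewrite ?undup_uniq //.
by move=> i; rewrite !mem_undup !mem_cat orbC.
Qed.

Lemma size_bump_part r a s : a \in s -> size (bump_part r s a) = size s.
Proof. by move=> a_s; rewrite /= size_rem // prednK //; case: s a_s. Qed.

(** [powersum_mul_monomial] solved for [m_(r,s)], after applying [theta] and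
    multiplying by the power of [x - 1] proper to [r :: s]. The merged terms have
    one part less, so the last factor [x - 1] is left in front of them. *)
Lemma monomial_quantum_recursion (L : fieldType) (x : L)
    (theta : {lrmorphism symfun L -> symfun L}) :
  (forall k, (0 < k)%N -> theta (powersum L k) = (x ^+ k - 1)^-1 *: powersum L k) ->
  forall r s, (0 < r)%N -> 0%N \notin s -> (count_mem r s).+1%:R != 0 :> L ->
  (x - 1) ^+ (size s).+1 *: theta (monomial L (r :: s)) =
  (count_mem r s).+1%:R^-1 *:
    (((x - 1) * (x ^+ r - 1)^-1) *:
       (powersum L r * ((x - 1) ^+ size s *: theta (monomial L s))) +
     - (x - 1) *: \sum_(a <- undup s) (count_mem (r + a)%N (bump_part r s a))%:R *:
        ((x - 1) ^+ size s *: theta (monomial L (bump_part r s a)))).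
Proof.
move=> thetaE r s r0 s0 c0; set c := _.+1%:R in c0 *.
have -> : monomial L (r :: s) = c^-1 *: (powersum L r * monomial L s -
    \sum_(a <- undup s) (count_mem (r + a)%N (bump_part r s a))%:R *: monomial L (bump_part r s a)).
  by rewrite powersum_mul_monomial // addrK scalerA mulVf // scale1r.
rewrite linearZ linearB rmorphM linear_sum /= thetaE //.
rewrite [LHS]scalerA [_ * c^-1]mulrC -[LHS]scalerA; congr (_ *: _); rewrite scalerBr; congr (_ + _).
  rewrite -scalerAl -scalerAr !scalerA; congr (_ *: _).
  by rewrite exprS; ring.
rewrite scaleNr; congr (- _); rewrite !scaler_sumr; apply: eq_bigr => a _.
rewrite linearZ /= !scalerA; congr (_ *: _); rewrite exprS; ring.
Qed.

Section Specialization.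
Variable F : fieldType.
Local Notation K := (ratfun F).
Local Notation spec := (@symfun_spec1 F).

Lemma symfun_spec1_single nu (a : K) (b : F) : is_part nu -> ratval 1 a b ->
  spec (a *: powersums K nu) (b *: powersums F nu).
Proof.
move=> pnu ab; exists [:: nu], (fun=> a), (fun=> b); split.
- by rewrite /= pnu.
- by rewrite big_seq1.
- by rewrite big_seq1.
by [].
Qed.

Lemma symfun_spec1_0 : spec 0 0.
Proof. by exists [::], (fun=> 0), (fun=> 0); split=> //; rewrite big_nil. Qed.

Lemma symfun_spec1D f f' g g' : spec f g -> spec f' g' -> spec (f + f') (g + g').
Proof.
move=> [s1 [a1 [b1 [[u1 p1] -> -> v1]]]] [s2 [a2 [b2 [[u2 p2] -> -> v2]]]].
(* The index lists have to be duplicate free, hence the extension by zero. *)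
exists (undup (s1 ++ s2)).
exists (fun mu => (if mu \in s1 then a1 mu else 0) + (if mu \in s2 then a2 mu else 0)).
exists (fun mu => (if mu \in s1 then b1 mu else 0) + (if mu \in s2 then b2 mu else 0)).
split.
- split; first exact: undup_uniq.
  apply/allP => mu; rewrite mem_undup mem_cat => /orP[].
    exact/allP.
  exact/allP.
- under [RHS]eq_bigr do rewrite scalerDl.
  by rewrite big_split (sum_undup_catl s2 a1 _ u1) (sum_undup_catr s1 a2 _ u2).
- under [RHS]eq_bigr do rewrite scalerDl.
  by rewrite big_split (sum_undup_catl s2 b1 _ u1) (sum_undup_catr s1 b2 _ u2).
move=> mu _; apply: ratvalD; case: ifP => h; try exact: ratval0.
  exact: v1.
exact: v2.
Qed.

Lemma symfun_spec1_sum (I : eqType) (s : seq I) (f : I -> symfun K) (g : I -> symfun F) :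
  {in s, forall i, spec (f i) (g i)} -> spec (\sum_(i <- s) f i) (\sum_(i <- s) g i).
Proof.
elim: s => [|i s IH] H; first by rewrite !big_nil; exact: symfun_spec1_0.
rewrite !big_cons; apply: symfun_spec1D; first by apply: H; rewrite mem_head.
by apply: IH => j js; apply: H; rewrite inE js orbT.
Qed.

Lemma symfun_spec1Z a b f g : ratval 1 a b -> spec f g -> spec (a *: f) (b *: g).
Proof.
move=> ab [s [a' [b' [sP -> -> v]]]].
exists s, (fun mu => a * a' mu), (fun mu => b * b' mu); split => //.
- by rewrite scaler_sumr; apply: eq_bigr => mu _; rewrite scalerA.
- by rewrite scaler_sumr; apply: eq_bigr => mu _; rewrite scalerA.
by move=> mu /v; apply: ratvalM.
Qed.

Definition insert_part r (mu : seq nat) := sort geq (r :: mu).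

Lemma insert_part_is_part r mu : (0 < r)%N -> is_part mu -> is_part (insert_part r mu).
Proof.
move=> r0 /andP[_ mu0]; rewrite /is_part sort_sorted; last by move=> x y; apply: leq_total.
by rewrite mem_sort inE negb_or mu0 andbT eq_sym -lt0n.
Qed.

Lemma powersums_perm (L : comNzRingType) s t :
  perm_eq s t -> powersums L s = powersums L t.
Proof. exact: perm_big. Qed.

Lemma powersums_insert (L : comNzRingType) r mu :
  powersums L (insert_part r mu) = powersum L r * powersums L mu.
Proof.
rewrite (powersums_perm L (t := r :: mu)) ?perm_sort //.
by rewrite /powersums big_cons.
Qed.

Lemma symfun_spec1_powersum r f g : (0 < r)%N -> spec f g ->
  spec (powersum K r * f) (powersum F r * g).
Proof.
move=> r0 [s [a [b [[us /allP ps] -> -> v]]]]; rewrite !mulr_sumr.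
apply: symfun_spec1_sum => mu mus; rewrite -!scalerAr -!powersums_insert.
by apply: symfun_spec1_single; [apply/insert_part_is_part/ps | apply: v].
Qed.

(** The quotient of [x - 1] by [x ^ r - 1] is regular at 1 in this form. *)
Lemma geometric_quotient (L : fieldType) (x : L) r : x != 1 ->
  (x - 1) * (x ^+ r - 1)^-1 = (\sum_(i < r) x ^+ i)^-1.
Proof. by move=> x1; rewrite subrX1 invfM mulrA mulfV ?subr_eq0 // mul1r. Qed.

Lemma vgen_neq1 : vgen F != 1.
Proof.
rewrite /vgen -tofrac1 tofrac_eq; apply/eqP => /(congr1 (fun p : {poly F} => p`_1)).
by rewrite coefX coef1 => /eqP; rewrite oner_eq0.
Qed.

Hypothesis F0 : forall k, (0 < k)%N -> k%:R != 0 :> F.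

Lemma ratval_quantum_int r : (0 < r)%N ->
  ratval 1 ((vgen F - 1) * (vgen F ^+ r - 1)^-1) (r%:R^-1 : F).
Proof.
move=> r0; rewrite geometric_quotient ?vgen_neq1 //.
apply: ratvalV; first exact: F0.
have -> : r%:R = \sum_(i < r) 1 ^+ i :> F.
  by under eq_bigr do rewrite expr1n; rewrite sumr_const card_ord.
apply: ratval_sum => i; exact/ratvalX/ratval_vgen.
Qed.

Variable theta : {lrmorphism symfun K -> symfun K}.
Hypothesis thetaE : forall k : nat, (0 < k)%N ->
  theta (powersum K k) = (vgen F ^+ k - 1)^-1 *: powersum K k.

Lemma monomial_spec1 s : 0%N \notin s ->
  spec ((vgen F - 1) ^+ size s *: theta (monomial K s)) ((zee s)%:R^-1 *: powersums F s).
Proof.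
have [k] := ubnP (size s); elim: k s => // k IH [|r s] /= sk.
  move=> _; rewrite monomial_nil rmorph1.
  have -> : 1 = powersums K [::] by rewrite /powersums big_nil.
  apply: symfun_spec1_single => //; rewrite expr0 /zee big_nil invr1; exact: ratval1.
rewrite inE negb_or eq_sym -lt0n => /andP[r0 s0].
set c := (count_mem r s).+1.
have c0 : c%:R != 0 :> F by apply: F0.
have cK : c%:R != 0 :> K.
  apply/eqP => cK; have e : c%:R = 0 :> F.
    by apply: (ratval_uniq (ratval_nat 1 c)); rewrite cK; exact: ratval0.
  by rewrite e eqxx in c0.
rewrite (monomial_quantum_recursion thetaE r0 s0 cK).
have -> : (zee (r :: s))%:R^-1 *: powersums F (r :: s) =
  c%:R^-1 *: (r%:R^-1 *: (powersum F r * ((zee s)%:R^-1 *: powersums F s)) +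
    - (1 - 1) *: \sum_(a <- undup s) (count_mem (r + a)%N (bump_part r s a))%:R *:
        ((zee (bump_part r s a))%:R^-1 *: powersums F (bump_part r s a))).
  rewrite subrr oppr0 scale0r addr0 -scalerAr !scalerA zee_cons // -/c !natrM !invfM.
  by rewrite /powersums big_cons [_^-1 / c%:R]mulrC.
have v1 := ratval_vgen (1 : F).
have one1 := ratval1 (1 : F).
apply: symfun_spec1Z; first exact: ratvalV (ratval_nat _ _).
apply: symfun_spec1D.
  apply: symfun_spec1Z; first exact: ratval_quantum_int.
  by apply: symfun_spec1_powersum => //; apply: IH.
(* The value [1 - 1] of [v - 1] kills the merged terms. *)
apply: symfun_spec1Z; first by apply/ratvalN/ratvalD => //; apply: ratvalN.
apply: symfun_spec1_sum => a; rewrite mem_undup => a_s.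
apply: symfun_spec1Z; first exact: ratval_nat.
rewrite -(size_bump_part r a_s); apply: IH; first by rewrite size_bump_part.
rewrite inE negb_or eq_sym addn_eq0 negb_and -lt0n r0 /=.
by apply: contra s0; apply: mem_rem.
Qed.

End Specialization.

(** * Geck-Rouquier elements and the theorem *)

Section GeckRouquier.
Import Num.Theory mpoly.
Variables (F : numFieldType) (n : nat) (f : 'S_n -> intpart n -> ratfun F).
Hypothesis fP : is_class_polys f.

(** Comparing coefficients in the trace identities for all contents expresses the
    power sum product of the cycle type of [w] in terms of all of them, with the
    values of the [f w l] as coefficients; these are therefore determined. *)
Lemma class_poly_spec1 w l : ratval 1 (f w l) (cycle_type w == parts l)%:R.
Proof.
have [phi phiP] : exists phi : intpart n -> F, forall l, ratval 1 (f w l) (phi l).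
  have ex k : exists b, ratval 1 (f w k) b.
    by apply: int_laurent_regular; [exact: oner_neq0 | exact: (fP w).1].
  by have [phi phiP] := fin_all_exists ex; exists phi.
suff /(_ l)/eqP : forall k, phi k - (cycle_type w == parts k)%:R = 0.
  by rewrite subr_eq0 => /eqP <-.
apply: power_product_free => m.
under eq_bigr => k _ do rewrite mulrBl.
rewrite big_split sumrN /=; apply/eqP; rewrite subr_eq0; apply/eqP.
have CP : perm_invariant (fun x => content x == m) by move=> v x; rewrite content_perm.
have := class_polys_fixed fP CP phiP; rewrite mcoeff_fixed_words.
rewrite (eq_bigr (fun k => phi k * (power_product F n (parts k))@_m)) => [<-|k _]; last first.
  by rewrite mcoeff_fixed_words cycle_type_wpart.
have [l0 l0E] := cycle_type_part w.
rewrite (bigD1 l0) //= l0E eqxx mul1r big1 ?addr0 // => k /negPf kl0.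
by rewrite -l0E (inj_eq (@parts_inj n)) eq_sym kl0 mul0r.
Qed.

(** The coefficient of [T_w] comes from [w^-1], which has the cycle type of
    [w]. *)
Lemma geck_rouquier_spec1 l : hecke_spec1 (geck_rouquier f l) (class_sum_elt F l).
Proof.
exists (fun w => vgen F ^- slength w^-1%g * f w^-1%g l); split.
  have reidx (V : zmodType) (g : 'S_n -> V) : \sum_w g w = \sum_w g w^-1%g.
    exact: (reindex_inj invg_inj).
  apply: etrans (reidx _ _) _; apply: eq_bigr => w _.
  exact: (congr1 (fun u => (vgen F ^- slength w^-1%g * f w^-1%g l) *: Tw F u) (invgK w)).
move=> w; rewrite class_sum_eltE -[X in ratval _ _ X]mul1r; apply: ratvalM.
  have := ratvalV _ (ratvalX (slength w^-1%g) (ratval_vgen (1 : F))).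
  by rewrite expr1n invr1; apply; apply: oner_neq0.
by rewrite -cycle_typeV; exact: class_poly_spec1.
Qed.

End GeckRouquier.

Local Open Scope complex_scope.

Theorem proposition4p9 (R : realType)
    (f : forall n, 'S_n -> intpart n -> ratfun R[i])
    (f_class : forall n, is_class_polys (f n))
    (fstar : forall n, intpart n -> center (heckev R[i] n))
    (fstarE : forall n (l : intpart n), \val (fstar n l) = geck_rouquier (f n) l)
    (theta : {lrmorphism symfun (ratfun R[i]) -> symfun (ratfun R[i])})
    (thetaE : forall k : nat, (0 < k)%N ->
       theta (powersum (ratfun R[i]) k) =
       (vgen R[i] ^+ k - 1)^-1 *: powersum (ratfun R[i]) k)
    (Psi : {linear ZHecke R[i] -> symfun (ratfun R[i])})
    (PsiE : forall n (l : intpart n),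
       Psi (dinj (fstar n l)) =
       (vgen R[i] - 1) ^+ size (parts l) *:
         theta (monomial (ratfun R[i]) (parts l)))
    (psi : {linear ZSym R[i] -> symfun R[i]})
    (psiE : forall n (l : intpart n),
       psi (dinj (class_sum R[i] l)) =
       (zee (parts l))%:R^-1 *: powersums R[i] (parts l)) :
  forall n (l : intpart n),
    hecke_spec1 (\val (fstar n l)) (\val (class_sum R[i] l)) /\
    symfun_spec1 (Psi (dinj (fstar n l))) (psi (dinj (class_sum R[i] l))).
Proof.
move=> n l; split; first by rewrite fstarE; exact: geck_rouquier_spec1.
rewrite PsiE psiE; apply: monomial_spec1 thetaE _ _.
  by move=> k k0; rewrite Num.Theory.pnatr_eq0 -lt0n.
by have /andP[] := parts_is_part l.
Qed.
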